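(* Every two-dimensional topological similarity class in $\mathrm{Aut}(\mathbb{QU}_{\prec})$ is meager in $\mathrm{Aut}(\mathbb{QU}_{\prec})\times\mathrm{Aut}(\mathbb{QU}_{\prec})$.
   Context: $\mathbb{QU}_{\prec}$ (the randomly ordered rational Urysohn space) is the Fraïssé limit of the class of all finite ordered metric spaces with rational distances, where an ordered metric space is a triple $(A,d,<)$ with $d$ a metric and $<$ an arbitrary linear order on $A$; equivalently, it is the unique countable ordered metric space with rational distances into which every finite ordered metric space with rational distances embeds (isometrically and order-preservingly) and in which every isometric order-preserving bijection between finite subsets extends to an automorphism. $\mathrm{Aut}(\mathbb{QU}_{\prec})$ is the group of order-preserving isometric bijections of $\mathbb{QU}_{\prec}$, with the topology of pointwise convergence ($\mathbb{QU}_{\prec}$ taken discrete). For a topological group $K$, a pair $(g_1,g_2)\in K^2$ is topologically similar to $(f_1,f_2)\in K^2$ if the map $g_i\mapsto f_i$ ($i=1,2$) extends to a group isomorphism $\langle g_1,g_2\rangle\to\langle f_1,f_2\rangle$ that is a homeomorphism with respect to the subspace topologies; its equivalence classes are the two-dimensional topological similarity classes. *)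

(* Defs.v *)
From Stdlib Require List.
From HB Require Import structures.
From mathcomp Require Import all_boot all_order all_algebra.
Set Implicit Arguments. Unset Strict Implicit. Unset Printing Implicit Defensive.
Import Order.TTheory GRing.Theory Num.Theory.
Local Open Scope ring_scope.

Definition is_ometric (T : Type) (d : T -> T -> rat) (lt : T -> T -> Prop) : Prop :=
  [/\ (forall x y, 0 <= d x y),
      (forall x y, d x y = 0 <-> x = y),
      (forall x y, d x y = d y x),
      (forall x y z, d x z <= d x y + d y z) &
      [/\ (forall x, ~ lt x x),
          (forall x y z, lt x y -> lt y z -> lt x z) &
          (forall x y, x <> y -> lt x y \/ lt y x)]].

(** Characterisation of QU_prec (Fraisse limit): countable ordered rational
    metric space, universal for finite ordered rational metric spaces
    (finite spaces are represented on 'I_n) and ultrahomogeneous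
    (finite partial isomorphisms are given by two n-tuples a, b with
    a i |-> b i). *)
Definition is_QUprec (M : Type) (d : M -> M -> rat) (lt : M -> M -> Prop) : Prop :=
  [/\ is_ometric d lt,
      (exists f : M -> nat, injective f),
      (forall (n : nat) (dA : 'I_n -> 'I_n -> rat) (ltA : 'I_n -> 'I_n -> Prop),
          is_ometric dA ltA ->
          exists e : 'I_n -> M,
            forall i j, d (e i) (e j) = dA i j /\ (lt (e i) (e j) <-> ltA i j)) &
      (forall (n : nat) (a b : 'I_n -> M),
          (forall i j, d (a i) (a j) = d (b i) (b j)) ->
          (forall i j, lt (a i) (a j) <-> lt (b i) (b j)) ->
          exists h : M -> M,
            [/\ bijective h,
                (forall x y, d (h x) (h y) = d x y),
                (forall x y, lt (h x) (h y) <-> lt x y) &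
                (forall i, h (a i) = b i)])].

Section AutDefs.
Variables (M : Type) (d : M -> M -> rat) (lt : M -> M -> Prop).

Definition is_aut (h : M -> M) : Prop :=
  [/\ bijective h,
      (forall x y, d (h x) (h y) = d x y) &
      (forall x y, lt (h x) (h y) <-> lt x y)].

Definition agree (h k : M -> M) (F : seq M) : Prop :=
  forall x, List.In x F -> h x = k x.

(** Topology of pointwise convergence on Aut(M) (M discrete):
    basic neighbourhoods of h are {k in Aut | k agrees with h on finite F}. *)
Definition open1 (O : (M -> M) -> Prop) : Prop :=
  (forall h, O h -> is_aut h) /\
  (forall h, O h -> exists F : seq M, forall k, is_aut k -> agree k h F -> O k).

Definition aut2 (p : (M -> M) * (M -> M)) : Prop := is_aut p.1 /\ is_aut p.2.

Definition open2 (O : (M -> M) * (M -> M) -> Prop) : Prop :=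
  (forall p, O p -> aut2 p) /\
  (forall p, O p -> exists F : seq M,
      forall q, aut2 q -> agree q.1 p.1 F -> agree q.2 p.2 F -> O q).

Definition interior2 (A : (M -> M) * (M -> M) -> Prop) p : Prop :=
  exists O, [/\ open2 O, (forall q, O q -> A q) & O p].

Definition closure2 (A : (M -> M) * (M -> M) -> Prop) p : Prop :=
  aut2 p /\ ~ interior2 (fun q => aut2 q /\ ~ A q) p.

Definition nowhere_dense2 (A : (M -> M) * (M -> M) -> Prop) : Prop :=
  forall p, ~ interior2 (closure2 A) p.

Definition meager2 (A : (M -> M) * (M -> M) -> Prop) : Prop :=
  exists S : nat -> ((M -> M) * (M -> M) -> Prop),
    (forall n, nowhere_dense2 (S n)) /\ (forall p, A p -> exists n, S n p).

Inductive gen (g1 g2 : M -> M) : (M -> M) -> Prop :=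
  | gen_l : gen g1 g2 g1
  | gen_r : gen g1 g2 g2
  | gen_id : gen g1 g2 id
  | gen_comp x y : gen g1 g2 x -> gen g1 g2 y -> gen g1 g2 (x \o y)
  | gen_inv x y : gen g1 g2 x -> cancel x y -> cancel y x -> gen g1 g2 y.

Definition cont_on (H : (M -> M) -> Prop) (phi : (M -> M) -> (M -> M)) : Prop :=
  forall O, open1 O ->
    exists O', open1 O' /\ forall x, H x -> (O (phi x) <-> O' x).

Definition top_similar (g1 g2 f1 f2 : M -> M) : Prop :=
  let H := gen g1 g2 in let K := gen f1 f2 in
  exists phi psi : (M -> M) -> (M -> M),
    [/\ (forall x, H x -> K (phi x)) /\ (forall y, K y -> H (psi y)),
        (forall x, H x -> psi (phi x) = x),
        (forall y, K y -> phi (psi y) = y),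
        (forall x y, H x -> H y -> phi (x \o y) = phi x \o phi y) &
        [/\ phi g1 = f1, phi g2 = f2, cont_on H phi & cont_on K psi]].

Definition sim_class (g1 g2 : M -> M) (p : (M -> M) * (M -> M)) : Prop :=
  aut2 p /\ top_similar g1 g2 p.1 p.2.

End AutDefs.

(* Main.v *)
Require Import Defs.
From HB Require Import structures.
From mathcomp Require Import all_boot all_order all_algebra.
From mathcomp Require Import lra zify.
From mathcomp Require Import boolp.
Set Implicit Arguments. Unset Strict Implicit. Unset Printing Implicit Defensive.
Import Order.TTheory GRing.Theory Num.Theory.
Local Open Scope ring_scope.

(** Let [x0] be moved by [g1] or [g2] (if there is no such point, the class is
    contained in the nowhere dense set of pairs whose first entry is the
    identity).  If [p] is topologically similar to [g], continuity at the
    identity gives a finite set [F] such that every word [w] with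
    [w(g) x0 <> x0] moves a point of [F] under [p].  For a fixed [F] the set of
    such [p] is nowhere dense: given a finite part of a pair [P] of
    automorphisms and a finite set [A], one extends that part to a pair [P'] for
    which some word [w] with [w(g) x0 <> x0] fixes [A] pointwise.

    This word is [u^-1 s u], where [s] is one of the two generators and [u]
    brings [A] into a position in which [s] may be declared to be the identity
    on [u A].  The word [u] is a product of large powers of the generators,
    taken alternately, and the automorphisms are extended as freely as possible
    along the way: new distances are as large as the triangle inequality
    permits, and images are pushed to the end of their cut.  A large power of a
    generator then carries a point past everything below the next fixed point of
    that generator, and makes its distances to old points factor through such
    fixed points.  Alternation leaves only the common fixed points: every point
    of [u A] lies just below the next common fixed point, and its distances to
    old points factor through common fixed points, so [s] preserves its type.
    Words are chosen with reference to [g], so whether they are reduced does not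
    matter: if [s] fixes [u(g) x0] in [g], one more power of [s] makes the other
    generator available, and the two cannot both fix [u(g) x0]. *)

(** * Minima, bounds and counting over finite lists *)

Section FiniteBounds.
Variable T : eqType.
Implicit Type s : seq T.

Fixpoint seq_argmin (f : T -> rat) (a : T) s : T :=
  if s is b :: s' then
    let m := seq_argmin f b s' in if f a <= f m then a else m
  else a.

Lemma seq_argmin_mem f a s : seq_argmin f a s \in a :: s.
Proof.
elim: s a => [|b s IH] a /=; first by rewrite inE eqxx.
case: ifP => _; first by rewrite inE eqxx.
by rewrite inE IH orbT.
Qed.

Lemma seq_argmin_le f a s b : b \in a :: s -> f (seq_argmin f a s) <= f b.
Proof.
elim: s a => [|c s IH] a /=; first by rewrite inE => /eqP ->.
rewrite inE => /orP[/eqP ->|bs].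
  by case: ifP => // /negbT; rewrite -ltNge => /ltW.
case: ifP => [le1|_]; last exact: IH.
exact: le_trans le1 (IH _ bs).
Qed.

Lemma seq_ubound s (f : T -> T -> rat) :
  exists2 R, 0 <= R & {in s &, forall x y, f x y <= R}.
Proof.
suff H : forall l : seq (T * T), exists2 R, 0 <= R & {in l, forall p, f p.1 p.2 <= R}.
  have [R R0 HR] := H [seq (x, y) | x <- s, y <- s].
  exists R => // x y xs ys; apply: (HR (x, y)).
  by apply/allpairsP; exists (x, y).
elim=> [|p l [R R0 IH]]; first by exists 0.
exists (Num.max R (f p.1 p.2)); first by rewrite le_max R0.
move=> q; rewrite inE => /orP[/eqP ->|/IH h]; rewrite le_max ?lexx ?orbT //.
by rewrite h.
Qed.

Lemma seq_pos_lbound s (f : T -> T -> rat) :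
  exists2 e, 0 < e & {in s &, forall x y, 0 < f x y -> e <= f x y}.
Proof.
suff H : forall l : seq (T * T),
    exists2 e, 0 < e & {in l, forall p, 0 < f p.1 p.2 -> e <= f p.1 p.2}.
  have [R R0 HR] := H [seq (x, y) | x <- s, y <- s].
  exists R => // x y xs ys; apply: (HR (x, y)).
  by apply/allpairsP; exists (x, y).
elim=> [|p l [R R0 IH]]; first by exists 1.
case: (ltP 0 (f p.1 p.2)) => [fp|fp].
  exists (Num.min R (f p.1 p.2)); first by rewrite lt_min R0.
  move=> q; rewrite inE => /orP[/eqP -> _|/IH h /h h']; rewrite ge_min ?lexx ?orbT //.
  by rewrite h'.
exists R => // q; rewrite inE => /orP[/eqP ->|/IH h]; first by rewrite ltNge fp.
exact: h.
Qed.

Lemma count_lt s (p q : pred T) y :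
  y \in s -> subpred p q -> ~~ p y -> q y -> (count p s < count q s)%N.
Proof.
move=> ys pq npy qy; elim: s ys => // a s IH; rewrite inE /= => /orP[/eqP <-|/IH lt1].
  by rewrite (negbTE npy) qy add0n add1n ltnS; apply: sub_count.
rewrite -addnS; apply: leq_add => //.
by case: (boolP (p a)) => // /pq ->.
Qed.

End FiniteBounds.

(** * Partial automorphisms of an ordered metric space *)

Section OrderedMetric.
Variables (disp : Order.disp_t) (M : orderType disp) (d : M -> M -> rat).

(** The inverse is stored as data, so that inverse letters of words can be evaluated directly. *)
Record raut := Raut {
  fw :> M -> M;
  bw : M -> M;
  fwK : cancel fw bw;
  bwK : cancel bw fw;
  raut_dist : forall x y, d (fw x) (fw y) = d x y;
  raut_lt : forall x y, (fw x < fw y)%O = (x < y)%O }.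

Lemma raut_inj (h : raut) : injective h.
Proof. exact: can_inj (fwK h). Qed.

Lemma raut_le (h : raut) x y : (h x <= h y)%O = (x <= y)%O.
Proof. by rewrite !le_eqVlt raut_lt (inj_eq (@raut_inj h)). Qed.

Lemma rinv_dist (h : raut) x y : d (bw h x) (bw h y) = d x y.
Proof. by rewrite -[LHS](raut_dist h) !bwK. Qed.

Lemma rinv_lt (h : raut) x y : (bw h x < bw h y)%O = (x < y)%O.
Proof. by rewrite -[LHS](raut_lt h) !bwK. Qed.

Definition rinv (h : raut) : raut :=
  Raut (bwK h) (fwK h) (rinv_dist h) (rinv_lt h).

Lemma iter_raut_dist (h : raut) i x y : d (iter i h x) (iter i h y) = d x y.
Proof. by elim: i => //= i IH; rewrite raut_dist. Qed.

Lemma iter_raut_le (h : raut) i x y : (iter i h x <= iter i h y)%O = (x <= y)%O.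
Proof. by elim: i => //= i IH; rewrite raut_le. Qed.

Lemma iter_raut_lt (h : raut) i x y : (iter i h x < iter i h y)%O = (x < y)%O.
Proof. by elim: i => //= i IH; rewrite raut_lt. Qed.

Lemma iter_fix (h : raut) i c : h c = c -> iter i h c = c.
Proof. by move=> hc; elim: i => //= i ->. Qed.

(** * Free extension of a partial automorphism *)

Hypothesis d_ge0 : forall x y, 0 <= d x y.
Hypothesis d_eq0 : forall x y, d x y = 0 <-> x = y.
Hypothesis d_sym : forall x y, d x y = d y x.
Hypothesis d_tri : forall x y z, d x z <= d x y + d y z.

Lemma d_xx x : d x x = 0. Proof. exact/d_eq0. Qed.

Lemma d_gt0 x y : x != y -> 0 < d x y.
Proof.
move=> nxy; rewrite lt_def d_ge0 andbT; apply: contra nxy => /eqP/d_eq0 ->.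
by rewrite eqxx.
Qed.

(** One-point extension: [r] is a Katetov function on [B], and [L] is a cut of [B]. *)
Hypothesis realize : forall (B : seq M) (r : M -> rat) (L : pred M),
  {in B, forall b, 0 < r b} ->
  {in B &, forall b b', r b <= r b' + d b' b} ->
  {in B &, forall b b', d b b' <= r b + r b'} ->
  {in B &, forall b b', (b < b')%O -> L b' -> L b} ->
  exists e, {in B, forall b, d e b = r b /\ (b < e)%O = L b}.

Hypothesis homog : forall l : seq (M * M),
  {in l &, forall p q, d p.1 q.1 = d p.2 q.2 /\ (p.1 < q.1)%O = (p.2 < q.2)%O} ->
  exists h : raut, {in l, forall p, h p.1 = p.2}.

Lemma homog_ext (h : raut) (S : seq M) (l : seq (M * M)) :
  {in l &, forall p q, d p.1 q.1 = d p.2 q.2 /\ (p.1 < q.1)%O = (p.2 < q.2)%O} ->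
  {in l & S, forall p s, [/\ d p.1 s = d p.2 (h s), (p.1 < s)%O = (p.2 < h s)%O &
    (s < p.1)%O = (h s < p.2)%O]} ->
  exists h' : raut, {in S, h' =1 h} /\ {in l, forall p, h' p.1 = p.2}.
Proof.
move=> Hl HS.
have [|h' Hh'] := homog (l := [seq (s, h s) | s <- S] ++ l).
  move=> p q; rewrite !mem_cat => /orP[/mapP[s sS ->]|pl] /orP[/mapP[t tS ->]|ql] /=.
  - by rewrite raut_dist raut_lt.
  - have [e1 e2 e3] := HS q s ql sS.
    by rewrite d_sym e1 d_sym e3.
  - by have [e1 e2 e3] := HS p t pl tS.
  - exact: Hl.
exists h'; split=> [s sS|p pl]; last by apply: Hh'; rewrite mem_cat pl orbT.
by apply: (Hh' (s, h s)); rewrite mem_cat (map_f (fun s => (s, h s)) sS).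
Qed.

(** The image of [x] is realized over [B] and [h S] with the distances of the free amalgam, at the
    upper (for [u]) or lower end of the cut left by the images of [S]. The point [a0] makes the
    minimum over [S] meaningful. *)
Lemma ext1 (h : raut) (S B : seq M) (a0 x : M) (u : bool) :
  a0 \in S -> x \notin S ->
  exists h' : raut, [/\ {in S, h' =1 h},
    {in B, forall b, exists2 a, a \in S & d x a + d (h a) b <= d (h' x) b},
    (u -> {in B, forall b, (h' x < b)%O ->
             exists2 a, a \in S & (x < a)%O && (h a <= b)%O}) &
    (~~ u -> {in B, forall b, (b < h' x)%O ->
             exists2 a, a \in S & (a < x)%O && (b <= h a)%O})].
Proof.
move=> a0S xS.
(* A shortest path from the future image of [x] to [b] passes through [h (am b)]; its length [r b]
   is the largest distance that the triangle inequality permits. *)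
pose am b := seq_argmin (fun a => d x a + d (h a) b) a0 S.
pose r b := d x (am b) + d (h (am b)) b.
have Sx : a0 :: S =i S by move=> y; rewrite inE orb_idl // => /eqP ->.
have amS b : am b \in S by rewrite -Sx; apply: seq_argmin_mem.
have rle b a : a \in S -> r b <= d x a + d (h a) b.
  by rewrite -Sx => /(seq_argmin_le (fun a => d x a + d (h a) b)).
have xa a : a \in S -> x != a by move=> aS; apply: contra xS => /eqP ->.
pose L b := if u then ~~ has (fun a => (x < a)%O && (h a <= b)%O) S
            else has (fun a => (a < x)%O && (b <= h a)%O) S.
have [||||y Hy] := realize (B := B ++ map h S) (r := r) (L := L).
- move=> b _; rewrite /r; have := d_gt0 (xa _ (amS b)).
  by have := d_ge0 (h (am b)) b; lra.
- move=> b b' _ _; have := rle b _ (amS b').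
  by rewrite /r; have := d_tri (h (am b')) b' b; lra.
- move=> b b' _ _; rewrite /r.
  have := d_tri b (h (am b)) b'; have := d_tri (h (am b)) (h (am b')) b'.
  rewrite raut_dist; have := d_tri (am b) x (am b').
  by rewrite (d_sym (am b) x) (d_sym b (h (am b))); lra.
- move=> b b' _ _ bb'; rewrite /L; case: u {L} => /=.
    apply: contra => /hasP[a aS /andP[xa1 hab]]; apply/hasP; exists a => //.
    by rewrite xa1 (le_trans hab (ltW bb')).
  case/hasP=> a aS /andP[ax hab]; apply/hasP; exists a => //.
  by rewrite ax (le_trans (ltW bb') hab).
have yS s : s \in S -> d y (h s) = d x s /\ (h s < y)%O = (s < x)%O.
  move=> sS; have [|-> ->] := Hy (h s); first by rewrite mem_cat (map_f h sS) orbT.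
  split.
    apply/eqP; rewrite eq_le /r; apply/andP; split.
      by have := rle (h s) _ sS; rewrite d_xx addr0.
    by rewrite raut_dist; apply: d_tri.
  rewrite /L; case: u {L Hy} => /=.
    apply/idP/idP => [/hasPn /(_ _ sS)|sx].
      rewrite lexx andbT -leNgt le_eqVlt => /orP[/eqP e|//].
      by rewrite -e sS in xS.
    apply/hasPn => a aS; rewrite raut_le; apply/negP => /andP[xa1].
    by move/le_lt_trans/(_ sx)/lt_trans/(_ xa1); rewrite ltxx.
  apply/idP/idP => [/hasP[a aS /andP[ax]]|sx].
    by rewrite raut_le => /le_lt_trans; apply.
  by apply/hasP; exists s => //; rewrite sx lexx.
have [||h' [h'S /(_ (x, y))]] := @homog_ext h S [:: (x, y)].
- by move=> p q; rewrite !inE => /eqP -> /eqP -> /=; rewrite !d_xx !ltxx.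
- move=> p s; rewrite inE => /eqP -> sS /=; have [e1 e2] := yS _ sS.
  rewrite e1 e2; split=> //.
  have nys : y != h s.
    by apply: contra (xa _ sS) => /eqP e; move: e1; rewrite e d_xx => /esym/d_eq0 ->.
  by rewrite !lt_neqAle nys (xa _ sS) !leNgt e2.
rewrite inE eqxx => /(_ isT) /= h'x.
have HyB b : b \in B -> d y b = r b /\ (b < y)%O = L b.
  by move=> bB; apply: Hy; rewrite mem_cat bB.
exists h'; rewrite h'x; split=> //.
- by move=> b /HyB[-> _]; exists (am b).
- move=> ut b /HyB[_ e] yb; have : ~~ (b < y)%O by rewrite -leNgt ltW.
  by rewrite e /L ut negbK => /hasP.
- by move=> uf b /HyB[_ ->]; rewrite /L (negbTE uf) => /hasP.
Qed.

(* Intervals of [F] are half-open: a point of [F] belongs to the one on its right. *)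
Definition btw (F : seq M) (x y : M) :=
  has (fun c => (x < c)%O && (c <= y)%O) F.

Definition loc_const (F : seq M) (f : pred M) :=
  forall x y, (x <= y)%O -> ~~ btw F x y -> f x = f y.

Lemma btwP F x y : reflect (exists c, [/\ c \in F, (x < c)%O & (c <= y)%O]) (btw F x y).
Proof.
by apply: (iffP hasP) => [[c cF /andP[xc cy]]|[c [cF xc cy]]]; exists c => //; apply/andP.
Qed.

Lemma btw_trans_l F x y z : (x <= y)%O -> btw F y z -> btw F x z.
Proof.
move=> xy /btwP[c [cF xc cy]]; apply/btwP; exists c; split=> //.
exact: le_lt_trans xc.
Qed.

(** The conclusions of [ext1], with the flag read off at [x]. Witnesses come from the old domain [S]
    even when several points are added together. *)
Definition free_over (fl : pred M) (h : raut) (S B : seq M) (h' : raut) x :=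
  [/\ {in B, forall b, exists2 a, a \in S & d x a + d (h a) b <= d (h' x) b},
    (fl x -> {in B, forall b, (h' x < b)%O ->
             exists2 a, a \in S & (x < a)%O && (h a <= b)%O}) &
    (~~ fl x -> {in B, forall b, (b < h' x)%O ->
             exists2 a, a \in S & (a < x)%O && (b <= h a)%O})].

Lemma free_over_new fl h S B h' x : x \notin S -> free_over fl h S B h' x ->
  h' x \notin B.
Proof.
move=> xS [E1 _ _]; apply/negP => /E1[a aS]; rewrite d_xx.
have : 0 < d x a by apply: d_gt0; apply: contra xS => /eqP ->.
by have := d_ge0 (h a) (h' x); lra.
Qed.

(** Points are added one by one. A witness [a] that was itself added earlier is traded for one in
    [S]: for distances by the triangle inequality; for the order by the witness of [a] if [a] and
    [x] have the same flag. Otherwise a point of [F] separates them, and it serves as witness, being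
    fixed and in [S]. *)
Lemma ext (F : seq M) (fl : pred M) (h : raut) (S B X : seq M) (c0 : M) :
  c0 \in F -> {subset F <= S} -> {in F, forall c, h c = c} -> loc_const F fl ->
  exists h' : raut, {in S, h' =1 h} /\
    forall x, x \in X -> x \notin S -> free_over fl h S B h' x.
Proof.
move=> c0F FS hF lc; elim: X => [|x X [h1 [h1S IH]]]; first by exists h.
case: (boolP (x \in S ++ X)) => xSX.
  exists h1; split=> // y; rewrite inE => /orP[/eqP ->|yX] yS; apply: IH => //.
  by move: xSX; rewrite mem_cat (negbTE yS).
have c0SX : c0 \in S ++ X by rewrite mem_cat FS.
have [h2 [h2S E1 E2 E3]] := ext1 h1 B (fl x) c0SX xSX.
have h2S' y : y \in S -> h2 y = h1 y by move=> yS; apply: h2S; rewrite mem_cat yS.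
have h2X y : y \in X -> h2 y = h1 y by move=> yX; apply: h2S; rewrite mem_cat yX orbT.
have xc c : c \in F -> x != c.
  by move=> cF; apply: contra xSX => /eqP ->; rewrite mem_cat FS.
exists h2; split=> [y yS|y]; first by rewrite h2S' // h1S.
rewrite inE => /orP[/eqP -> _|yX yS]; last first.
  by have := IH _ yX yS; rewrite /free_over h2X.
split.
- move=> b bB; have [a aSX le1] := E1 _ bB.
  case: (boolP (a \in S)) => aS; first by exists a; rewrite // -h1S.
  have aX : a \in X by move: aSX; rewrite mem_cat (negbTE aS).
  have [/(_ _ bB) [a' a'S le2] _ _] := IH _ aX aS.
  by exists a' => //; have := d_tri x a a'; lra.
- move=> flx b bB /(E2 flx _ bB) [a aSX /andP[xa hab]].
  case: (boolP (a \in S)) => aS; first by exists a; rewrite // xa -h1S.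
  have aX : a \in X by move: aSX; rewrite mem_cat (negbTE aS).
  have fo := IH _ aX aS; case: (boolP (fl a)) => fla.
    have hab' : (h1 a < b)%O.
      rewrite lt_neqAle hab andbT; apply/eqP => e.
      by have := free_over_new aS fo; rewrite e bB.
    have [_ /(_ fla _ bB hab') [a' a'S /andP[aa' ha'b]] _] := fo.
    by exists a' => //; rewrite (lt_trans xa aa') ha'b.
  have /btwP[c [cF xlc cla]] : btw F x a.
    by apply: contraNT fla => /(lc _ _ (ltW xa)) <-.
  exists c; first exact: FS.
  rewrite xlc hF //; apply: le_trans hab.
  by rewrite -[c in (c <= _)%O]hF // -h1S ?FS // raut_le.
- move=> flx b bB /(E3 flx _ bB) [a aSX /andP[ax hab]].
  case: (boolP (a \in S)) => aS; first by exists a; rewrite // ax -h1S.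
  have aX : a \in X by move: aSX; rewrite mem_cat (negbTE aS).
  have fo := IH _ aX aS; case: (boolP (fl a)) => fla; last first.
    have hab' : (b < h1 a)%O.
      rewrite lt_neqAle hab andbT; apply/eqP => e.
      by have := free_over_new aS fo; rewrite -e bB.
    have [_ _ /(_ fla _ bB hab') [a' a'S /andP[aa' ha'b]]] := fo.
    by exists a' => //; rewrite (lt_trans aa' ax) ha'b.
  have /btwP[c [cF alc clx]] : btw F a x.
    by apply: contraNT flx => /(lc _ _ (ltW ax)) <-.
  exists c; first exact: FS.
  rewrite lt_neqAle eq_sym xc // clx hF //; apply: le_trans hab _.
  by rewrite -[c in (_ <= c)%O]hF // -h1S ?FS // raut_le ltW.
Qed.

(* [K] is the region in which the direction of motion is no longer controlled. *)
Record good (K : pred M) (F : seq M) (fl : pred M) (h : raut) (S : seq M) : Prop := Good {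
  good_sub : {subset F <= S};
  good_fix : {in F, forall c, h c = c};
  good_new : {in S, forall s, h s = s -> s \in F};
  good_coh : {in S, forall s, ~~ K s -> s \notin F -> (s < h s)%O = fl s} }.

(** If a new point moved against its flag, freeness would give a point of [S] that also moves that
    way. No point of [F] separates the two, as it is fixed, so this contradicts coherence on [S]. *)
Lemma good_ext K F fl h S B c0 :
  good K F fl h S -> c0 \in F -> loc_const F fl -> loc_const F K ->
  exists h' : raut, [/\ {in S, h' =1 h}, good K F fl h' (S ++ B) &
    forall x, x \in B -> x \notin S -> free_over fl h S B h' x].
Proof.
move=> [FS hF hn hc] c0F lcf lcK.
have [h' [h'S fo]] := ext B B c0F FS hF lcf.
exists h'; split=> //; split.
- by move=> c /FS cS; rewrite mem_cat cS.
- by move=> c cF; rewrite h'S ?FS // hF.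
- move=> s; case: (boolP (s \in S)) => sS; first by rewrite h'S // => _; apply: hn.
  rewrite mem_cat (negbTE sS) /= => sB e.
  by have := free_over_new sS (fo _ sB sS); rewrite e sB.
- move=> s; case: (boolP (s \in S)) => sS; first by rewrite h'S // => _; apply: hc.
  rewrite mem_cat (negbTE sS) /= => sB Ks sF.
  have /negbTE nhs : h' s != s.
    by apply: contraNneq (free_over_new sS (fo _ sB sS)) => ->.
  have [_ E2 E3] := fo _ sB sS.
  case: (boolP (fl s)) => fls.
    rewrite ltNge le_eqVlt nhs /=; apply/negP => /(E2 fls _ sB) [a aS /andP[sa has_]].
    have nb : ~~ btw F s a.
      apply/btwP => -[c [cF sc ca]].
      have : (c <= s)%O.
        by rewrite -[c]hF // (le_trans _ has_) // raut_le.
      by rewrite leNgt sc.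
    have aF : a \notin F.
      by apply: contraNN nb => aF; apply/btwP; exists a; rewrite aF sa lexx.
    have := hc _ aS; rewrite -(lcK _ _ (ltW sa) nb) Ks aF -(lcf _ _ (ltW sa) nb) fls.
    by move=> /(_ isT isT) aha; have := lt_trans (le_lt_trans has_ sa) aha; rewrite ltxx.
  apply/negbTE/negP => /(E3 fls _ sB) [a aS /andP[sa has_]].
  have nb : ~~ btw F a s.
    apply/btwP => -[c [cF ac cs]].
    have : (h a < c)%O by rewrite -[c]hF // raut_lt.
    by rewrite ltNge (le_trans cs has_).
  have aF : a \notin F.
    by apply/negP => /hF e; move: has_; rewrite e leNgt sa.
  have := hc _ aS; rewrite (lcK _ _ (ltW sa) nb) Ks aF (lcf _ _ (ltW sa) nb) (negbTE fls).
  by move=> /(_ isT isT) /negbT; rewrite -leNgt => aha; have := lt_le_trans sa (le_trans has_ aha); rewrite ltxx.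
Qed.

(** * Large powers of one partial automorphism *)

Lemma loc_const_iter F f (h : raut) i x :
  {in F, forall c, h c = c} -> loc_const F f -> f (iter i h x) = f x.
Proof.
move=> hF lc; case: (leP x (iter i h x)) => [le1|/ltW le1].
  apply/esym/lc => //; apply/btwP => -[c [cF xc]].
  by rewrite -[c](iter_fix i (hF _ cF)) iter_raut_le leNgt xc.
apply: lc => //; apply/btwP => -[c [cF xc cx]]; move: xc.
by rewrite -[c](iter_fix i (hF _ cF)) iter_raut_lt ltNge cx.
Qed.

(** The witness for a new image is an iterate [iter i h' y] with [y] in [B]. Cancelling [i]
    applications of the map splits the power [m] into two smaller powers that meet at [y]; repeated
    splitting leaves chains of single steps inside [B]. *)
Lemma iterate K F fl h B c0 n :
  good K F fl h B -> c0 \in F -> loc_const F fl -> loc_const F K ->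
  exists (h' : raut) T, [/\ {in B, h' =1 h}, good K F fl h' T,
    forall x i, x \in B -> (i <= n)%N -> iter i h' x \in T,
    forall v, v \in T -> exists x i, [/\ x \in B, (i <= n)%N & v = iter i h' x] &
    forall m x b, (1 < m <= n.+1)%N -> x \in B -> b \in B ->
      (exists s t y, [/\ (s + t)%N = m, (0 < s)%N, (0 < t)%N, y \in B &
         d (iter s h' x) y + d (iter t h' y) b <= d (iter m h' x) b]) /\
      (fl x -> (iter m h' x <= b)%O ->
       exists s t y, [/\ (s + t)%N = m, (0 < s)%N, (0 < t)%N, y \in B &
         (iter s h' x <= y)%O && (iter t h' y <= b)%O])].
Proof.
move=> gB c0F lcf lcK; elim: n => [|n [h1 [T [h1B gT inT Tin HT]]]].
  exists h, B; split=> //.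
  - by move=> x [|i].
  - by move=> v vB; exists v, 0%N.
  - by move=> [|[|m]].
pose X := [seq iter n.+1 h1 x | x <- B].
have [h2 [h2T gT2 fo]] := good_ext (X ++ B) gT c0F lcf lcK.
have it x i : x \in B -> (i <= n.+1)%N -> iter i h2 x = iter i h1 x.
  move=> xB; elim: i => // i IH lti; rewrite [LHS]/= IH; last exact: ltnW.
  by rewrite h2T //; apply: inT.
have BT x : x \in B -> x \in T by move=> xB; apply: (inT x 0%N).
exists h2, (T ++ (X ++ B)); split=> //.
- by move=> x xB; rewrite h2T ?BT // h1B.
- move=> x i xB; rewrite leq_eqVlt => /orP[/eqP ->|lti].
    by rewrite it // !mem_cat (map_f (iter n.+1 h1) xB) orbT.
  by rewrite it 1?ltnW // mem_cat inT.
- move=> v; rewrite !mem_cat => /or3P[/Tin[x [i [xB lei ->]]]|/mapP[x xB ->]|vB].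
  + by exists x, i; split=> //; [exact: ltnW | rewrite it // ltnW].
  + by exists x, n.+1; rewrite it.
  + by exists v, 0%N.
move=> m x b /andP[m1]; rewrite leq_eqVlt => /orP[/eqP ->|mn] xB bB; last first.
  have [|H1 H2] := HT m x b _ xB bB; first by rewrite m1 -ltnS.
  split.
    have [s [t [y [e s0 t0 yB le1]]]] := H1.
    by exists s, t, y; split=> //; rewrite !it //; lia.
  rewrite it // => flx /(H2 flx) [s [t [y [e s0 t0 yB le1]]]].
  by exists s, t, y; split=> //; rewrite !it //; lia.
set v := iter n.+1 h1 x.
have -> : iter n.+2 h2 x = h2 v by rewrite iterS it.
have vX : v \in X ++ B by rewrite mem_cat (map_f (iter n.+1 h1) xB).
have bXB : b \in X ++ B by rewrite mem_cat bB orbT.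
(* [R] stands for a distance equation or for the order; both are reflected by iterates. *)
have split_iter (R : M -> M -> Prop) a : a \in T -> R v a ->
    (forall i p q, R (iter i h1 p) (iter i h1 q) -> R p q) ->
    exists s t y, [/\ (s + t)%N = n.+2, (0 < s)%N, (0 < t)%N, y \in B &
      R (iter s h2 x) y /\ iter t h2 y = h1 a].
  move=> /Tin[y [i [yB lei ->]]] Rv Rinv.
  exists (n.+1 - i)%N, i.+1, y; split=> //; try lia.
  split; last by rewrite it.
  apply: (Rinv i); rewrite it //; last by lia.
  by rewrite -iterD subnKC //; lia.
split.
  have [a aT le1] : exists2 a, a \in T & d v a + d (h1 a) b <= d (h2 v) b.
    case: (boolP (v \in T)) => vT; first by exists v; rewrite // d_xx add0r h2T.
    by have [/(_ _ bXB)] := fo _ vX vT.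
  have [|s [t [y [e s0 t0 yB [E1 E2]]]]] := split_iter (fun p q => d p q = d v a) a aT erefl.
    by move=> i p q; rewrite iter_raut_dist.
  by exists s, t, y; split=> //; rewrite E1 E2.
move=> flx hvb.
have [a aT /andP[va hab]] : exists2 a, a \in T & (v <= a)%O && (h1 a <= b)%O.
  case: (boolP (v \in T)) => vT; first by exists v; rewrite // lexx -h2T.
  have flv : fl v by rewrite /v (loc_const_iter _ _ (good_fix gT) lcf).
  have hvb' : (h2 v < b)%O.
    rewrite lt_neqAle hvb andbT; apply/eqP => e.
    by have := free_over_new vT (fo _ vX vT); rewrite e bXB.
  have [_ /(_ flv _ bXB hvb') [a aT /andP[va hab]] _] := fo _ vX vT.
  by exists a; rewrite // ltW.
have [|s [t [y [e s0 t0 yB [E1 E2]]]]] := split_iter (fun p q => p <= q)%O a aT va.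
  by move=> i p q; rewrite iter_raut_le.
by exists s, t, y; split=> //; rewrite E1 E2.
Qed.

Definition pos_above (F : seq M) (h : raut) (S : seq M) x :=
  {in S, forall a, (x <= a)%O -> (a < h a)%O || btw F x a}.

(* Every step [y |-> h y] inside the finite set [B] that is not at a fixed point
   increases the rank [psi]; so a long chain of steps must either pass through a
   fixed point or pay at least a fixed positive distance many times. *)
Lemma long_iterate K F fl h B c0 :
  good K F fl h B -> c0 \in F -> loc_const F fl -> loc_const F K ->
  exists (h' : raut) T n, [/\ {in B, h' =1 h}, good K F fl h' T,
    forall x i, x \in B -> (i <= n)%N -> iter i h' x \in T,
    {in B &, forall x b, exists2 c, c \in F & d x c + d c b <= d (iter n.+1 h' x) b} &
    forall x, x \in B -> fl x -> pos_above F h B x ->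
      {in B, forall b, (iter n.+1 h' x <= b)%O -> btw F x b}].
Proof.
move=> gB c0F lcf lcK.
pose r y := count (fun b => (b < y)%O) B; pose sz := size B.
have r_sz y : (r y <= sz)%N by apply: count_size.
have r_lt y y' : y \in B -> (y < y')%O -> (r y < r y')%N.
  move=> yB yy'; apply: (count_lt yB) => //; last by rewrite ltxx.
  by move=> b /lt_trans; apply.
pose psi y := if (y < h y)%O then r y else (sz - r y)%N.
have psi_sz y : (psi y <= sz)%N by rewrite /psi; case: ifP => _ //; lia.
have [e e0 He] := seq_pos_lbound B (fun y y' => d (h y) y').
(* With this factor a step of positive length pays [sz + 1], more than any possible loss of rank. *)
pose k : rat := sz.+1%:R / e.
have k0 : 0 < k by rewrite divr_gt0 ?ltr0Sn.
have step y y' : y \in B -> y' \in B -> y \notin F ->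
    (1 + psi y)%N%:R <= k * d (h y) y' + (psi y')%:R.
  move=> yB y'B yF; case: (eqVneq (h y) y') => [hy|/d_gt0 dpos].
    rewrite hy d_xx mulr0 add0r ler_nat /psi -hy raut_lt.
    have hyB : h y \in B by rewrite hy.
    case: ifP => [lt1|/negbT]; first by have := r_lt _ _ yB lt1; lia.
    rewrite -leNgt le_eqVlt => /orP[/eqP e1|lt1].
      by rewrite (good_new gB yB e1) in yF.
    by have := r_lt _ _ hyB lt1; have := r_sz y; lia.
  have : sz.+1%:R <= k * d (h y) y'.
    by rewrite mulrAC ler_pdivlMr // ler_wpM2l // He.
  have : (1 + psi y)%N%:R <= (sz.+1%:R : rat) by rewrite ler_nat add1n ltnS.
  have : (0 : rat) <= (psi y')%:R by rewrite ler0n.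
  lra.
have [R R0 HR] := seq_ubound B (fun x b => d x c0 + d c0 b).
(* A chain of [n + 1] steps that avoids [F] has length above [R], so the path through [c0] is no
   longer than it. As [n] exceeds [sz], such a chain is also too long for the rank [r] that controls
   the order. *)
pose n := Num.bound (k * R + sz%:R).
have nbig : k * R + sz%:R < n%:R.
  by apply: archi_boundP; rewrite addr_ge0 ?ler0n // mulr_ge0 // ltW.
have nsz : (sz < n)%N.
  rewrite -(ltr_nat rat); apply: le_lt_trans nbig.
  by rewrite lerDr mulr_ge0 // ltW.
have [h' [T [h'B gT inT _ HT]]] := iterate n gB c0F lcf lcK.
have h'F c : c \in F -> h' c = c by move=> cF; apply: (good_fix gT).
have nn : (0 < n.+1 <= n.+1)%N by rewrite ltnS leqnn.
exists h', T, n; split=> //.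
  have claim m : (0 < m <= n.+1)%N -> {in B &, forall x b,
      (exists2 c, c \in F & d x c + d c b <= d (iter m h' x) b) \/
      (m + psi x)%N%:R <= k * d (iter m h' x) b + (psi b)%:R}.
    elim/ltn_ind: m => m IH /andP[m0 mn] x b xB bB.
    case: (boolP (x \in F)) => xF.
      by left; exists x; rewrite // d_xx add0r iter_fix ?h'F.
    case: (boolP (b \in F)) => bF.
      left; exists b; rewrite // d_xx addr0.
      by rewrite -{2}(iter_fix m (h'F _ bF)) iter_raut_dist.
    case: m m0 mn IH => [//|[|m]] _ mn IH.
      by right; rewrite /= h'B //; apply: step.
    have [|[s [t [y [est s0 t0 yB le1]]]] _] := HT m.+2 x b _ xB bB; first by rewrite mn.
    have ss : (s < m.+2)%N by rewrite -est -addn1 leq_add2l.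
    have tt : (t < m.+2)%N by rewrite -est -add1n leq_add2r.
    have sn : (0 < s <= n.+1)%N by rewrite s0 (leq_trans (ltnW ss) mn).
    have tn : (0 < t <= n.+1)%N by rewrite t0 (leq_trans (ltnW tt) mn).
    have [[c cF c1]|c1] := IH s ss sn x y xB yB.
      left; exists c => //.
      have e1 : d c (iter t h' y) = d c y.
        by rewrite -{1}(iter_fix t (h'F _ cF)) iter_raut_dist.
      by have := d_tri c (iter t h' y) b; rewrite e1; lra.
    have [[c cF c2]|c2] := IH t tt tn y b yB bB.
      left; exists c => //.
      have e1 : d (iter s h' x) c = d x c.
        by rewrite -{1}(iter_fix s (h'F _ cF)) iter_raut_dist.
      by have := d_tri (iter s h' x) y c; rewrite e1; lra.
    right; have := ler_wpM2l (ltW k0) le1; rewrite mulrDr -est.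
    by move: c1 c2; rewrite !natrD; lra.
  move=> x b xB bB; have [[c cF le1]|le1] := claim n.+1 nn x b xB bB.
    by exists c.
  exists c0 => //; apply: le_trans (HR _ _ xB bB) _.
  rewrite -(ler_pM2l k0).
  have : (psi b)%:R <= (sz%:R : rat) by rewrite ler_nat.
  have : (0 : rat) <= (psi x)%:R by rewrite ler0n.
  move: le1; rewrite natrD -[n.+1]addn1 natrD; lra.
have claim m : (0 < m <= n.+1)%N -> forall x b, x \in B -> b \in B -> fl x ->
    pos_above F h B x -> (iter m h' x <= b)%O -> btw F x b \/ (r x + m <= r b)%N.
  elim/ltn_ind: m => m IH /andP[m0 mn] x b xB bB flx px.
  case: m m0 mn IH => [//|[|m]] _ mn IH hxb.
    case: (boolP (btw F x b)) => nb; [by left|right].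
    have : (x < h x)%O.
      have := px x xB (lexx _) => /orP[//|/btwP[c [_ xc cx]]].
      by move: xc; rewrite ltNge cx.
    rewrite addn1 => xhx; apply: r_lt => //; apply: lt_le_trans xhx _.
    by rewrite -h'B.
  have [|_ /(_ flx hxb) [s [t [y [est s0 t0 yB /andP[le1 le2]]]]]] := HT m.+2 x b _ xB bB.
    by rewrite mn.
  case: (boolP (btw F x b)) => nb; [by left|right].
  have nxy : ~~ btw F x y.
    apply: contraNN nb => /btwP[c [cF xc cy]]; apply/btwP; exists c; split=> //.
    apply: le_trans le2; by rewrite -[c](iter_fix t (h'F _ cF)) iter_raut_le.
  have ss : (s < m.+2)%N by rewrite -est -addn1 leq_add2l.
  have tt : (t < m.+2)%N by rewrite -est -add1n leq_add2r.
  have sn : (0 < s <= n.+1)%N by rewrite s0 (leq_trans (ltnW ss) mn).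
  have tn : (0 < t <= n.+1)%N by rewrite t0 (leq_trans (ltnW tt) mn).
  have [c1|c1] := IH s ss sn x y xB yB flx px le1.
    by rewrite c1 in nxy.
  have xy : (x <= y)%O.
    rewrite leNgt; apply/negP => /(r_lt _ _ yB).
    by rewrite ltnNge (leq_trans (leq_addr s _) c1).
  have [|||c2|c2] := IH t tt tn y b yB bB.
  - by rewrite -(lcf _ _ xy nxy).
  - move=> a aB ya; have := px a aB (le_trans xy ya) => /orP[->//|/btwP[c [cF xc ca]]].
    apply/orP; right; apply/btwP; exists c; split=> //.
    rewrite ltNge; apply: contraNN nxy => cy.
    by apply/btwP; exists c.
  - exact: le2.
  - by rewrite (btw_trans_l xy c2) in nb.
  - by rewrite -est addnA (leq_trans _ c2) // leq_add2r.
move=> x xB flx px b bB hxb; have [//|] := claim n.+1 nn x b xB bB flx px hxb.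
by rewrite leqNgt (leq_ltn_trans (r_sz b)) // (ltn_trans nsz) // addnS ltnS leq_addl.
Qed.

(** First [B] is put into the domain. The new points inherit [pos_above]: one moving down would have
    a witness in [S] that also moves down, unless a point of [F] intervenes. *)
Lemma phase K F fl h S B c0 :
  good K F fl h S -> c0 \in F -> loc_const F fl -> loc_const F K ->
  exists (h' : raut) T n, [/\ {in S, h' =1 h}, good K F fl h' T,
    forall x i, x \in S ++ B -> (i <= n)%N -> iter i h' x \in T,
    {in B &, forall x b, exists2 c, c \in F & d x c + d c b <= d (iter n.+1 h' x) b} &
    forall x, x \in B -> fl x -> pos_above F h S x ->
      {in B, forall b, (iter n.+1 h' x <= b)%O -> btw F x b}].
Proof.
move=> gS c0F lcf lcK.
have [h1 [h1S g1 fo]] := good_ext B gS c0F lcf lcK.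
have [h2 [T [n [h2S g2 inT HM HO]]]] := long_iterate g1 c0F lcf lcK.
have BSB b : b \in B -> b \in S ++ B by move=> bB; rewrite mem_cat bB orbT.
exists h2, T, n; split=> //.
- by move=> s sS; rewrite h2S ?h1S // mem_cat sS.
- by move=> x b xB bB; apply: HM; apply: BSB.
move=> x xB flx px b bB; apply: HO (BSB _ bB) => //; first exact: BSB.
move=> a; case: (boolP (a \in S)) => aS; first by rewrite h1S // => _; apply: px.
rewrite mem_cat (negbTE aS) /= => aB xa.
case: (boolP (btw F x a)) => nb; first by rewrite orbT.
rewrite orbF ltNge le_eqVlt negb_or.
have fa := fo _ aB aS; apply/andP; split.
  by apply: contraNneq (free_over_new aS fa) => ->.
have fla : fl a by rewrite -(lcf _ _ xa nb).
have [_ /(_ fla _ aB) E2 _] := fa.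
apply/negP => /E2 [a' a'S /andP[aa' ha'a]].
have := px a' a'S (le_trans xa (ltW aa')) => /orP[lt1|/btwP[c [cF xc ca']]].
  by have := lt_trans (le_lt_trans ha'a aa') lt1; rewrite ltxx.
move/negP: nb; apply; apply/btwP; exists c; split=> //.
by apply: le_trans ha'a; rewrite -[c](good_fix gS cF) raut_le.
Qed.

(** * Powers of either sign *)

Lemma good_rinv K F fl h S : good K F fl h S -> loc_const F fl -> loc_const F K ->
  good K F (predC fl) (rinv h) (map h S).
Proof.
move=> [FS hF hn hc] lcf lcK.
have lc1 f x : loc_const F f -> f (h x) = f x by apply: (loc_const_iter 1).
split.
- by move=> c cF; rewrite -[c]hF // map_f // FS.
- by move=> c cF; rewrite /= -[X in bw h X]hF // fwK.
- move=> _ /mapP[s sS ->]; rewrite /= fwK => e.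
  by rewrite -e; apply: hn.
move=> _ /mapP[s sS ->]; rewrite /= fwK !lc1 // => Ks sF.
have sF' : s \notin F by apply: contraNN sF => sF; rewrite hF.
rewrite -hc // -leNgt le_eqVlt orb_idl // => /eqP e.
by rewrite hn in sF'.
Qed.

Lemma good_flag K F fl fl' h S : (forall x, ~~ K x -> fl x = fl' x) ->
  good K F fl h S -> good K F fl' h S.
Proof.
move=> ff [FS hF hn hc]; split=> // s sS Ks sF.
by rewrite hc // ff.
Qed.

Lemma pos_above_good K F fl h S x : good K F fl h S -> loc_const F fl -> loc_const F K ->
  ~~ K x -> fl x -> x \notin F -> pos_above F h S x.
Proof.
move=> g lcf lcK Kx fx xF a aS xa.
case: (boolP (btw F x a)) => nb; first by rewrite orbT.
rewrite orbF (good_coh g) //; first by rewrite -(lcf _ _ xa nb).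
  by rewrite -(lcK _ _ xa nb).
apply/negP => aF; move: xa; rewrite le_eqVlt => /orP[/eqP e|xa].
  by rewrite e aF in xF.
by move/negP: nb; apply; apply/btwP; exists a; rewrite lexx.
Qed.

Definition dir (sg : bool) (h : raut) := if sg then h else rinv h.

(** A negative sign is handled by extending the inverse and inverting the result. The values on [T]
    determine the power on [B], so later extensions do not disturb it. *)
Lemma signed_phase K F up (p : raut) (S B : seq M) c0 sg :
  good K F up p S -> c0 \in F -> loc_const F up -> loc_const F K ->
  exists (p' : raut) (T : seq M) n, [/\ {in S, p' =1 p} /\ {subset S <= T}, good K F up p' T,
    (forall p'' : raut, {in T, p'' =1 p'} ->
       {in B, iter n.+1 (dir sg p'') =1 iter n.+1 (dir sg p')}),
    {in B &, forall x b, exists2 c, c \in F &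
       d x c + d c b <= d (iter n.+1 (dir sg p') x) b} &
    forall x, x \in B ->
      [/\ ~~ K x, up x = sg & x \notin F] \/
      K x /\ {in S ++ map p S, forall a, (x <= a)%O -> btw F x a} ->
      {in B, forall b, (iter n.+1 (dir sg p') x <= b)%O -> btw F x b}].
Proof.
move=> gS c0F lcu lcK.
(* Inside [K] new images are always pushed up; outside, the flag is the recorded direction of
   [dir sg p]. *)
pose fl x := K x || (up x == sg).
have lcf : loc_const F fl.
  by move=> x y xy nb; rewrite /fl (lcu _ _ xy nb) (lcK _ _ xy nb).
pose h := dir sg p; pose Sh := if sg then S else map p S.
have gh : good K F fl h Sh.
  rewrite /h /Sh /fl; case: sg {fl lcf h Sh} => /=.
    by apply: good_flag gS => x /negbTE ->; rewrite eqb_id.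
  apply: good_flag (good_rinv gS lcu lcK) => x /negbTE -> /=.
  by rewrite eqbF_neg.
have [h' [T [n [h'S gT inT HM HO]]]] := phase B gh c0F lcf lcK.
have inT0 x : x \in Sh -> x \in T.
  by move=> xS; apply: (inT x 0%N); rewrite // mem_cat xS.
have stable (k : raut) : {in T, k =1 h'} -> {in B, iter n.+1 k =1 iter n.+1 h'}.
  move=> kh x xB; have : (n.+1 <= n.+1)%N by [].
  elim: {1 3 4}n.+1 => // i IH lti; rewrite !iterS IH; last exact: ltnW.
  by apply: kh; apply: inT; rewrite // mem_cat xB orbT.
have HO' x : x \in B -> [/\ ~~ K x, up x = sg & x \notin F] \/
      K x /\ {in S ++ map p S, forall a, (x <= a)%O -> btw F x a} ->
      {in B, forall b, (iter n.+1 h' x <= b)%O -> btw F x b}.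
  move=> xB [[Kx ux xF]|[Kx top]]; apply: HO => //.
  - by rewrite /fl ux eqxx orbT.
  - by apply: pos_above_good gh lcf lcK Kx _ xF; rewrite /fl ux eqxx orbT.
  - by rewrite /fl Kx.
  - move=> a aS xa; rewrite (top a) ?orbT //.
    by rewrite mem_cat; move: aS; rewrite /Sh; case: ifP => _ ->; rewrite ?orbT.
exists (dir sg h'), (if sg then T else map h' T), n.
move: stable gT gh h'S inT0 HM HO' {HO inT}.
rewrite /h /Sh /fl; case: sg {fl lcf h Sh} => /= stable gT gh h'S inT0 HM HO.
  split=> //; apply: good_flag gT => x /negbTE -> /=; exact: eqb_id.
split=> //.
- have key s : s \in S -> h' (p s) = s by move=> sS; rewrite h'S ?map_f //= fwK.
  split=> s sS; first by rewrite /= -{1}(key _ sS) fwK.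
  by rewrite -(key _ sS) map_f // inT0 // map_f.
- have g1 : good K F (predC up) h' T.
    by apply: good_flag gT => x /negbTE -> /=; rewrite eqbF_neg.
  have lcu' : loc_const F (predC up) by move=> x y xy nb /=; rewrite (lcu _ _ xy nb).
  apply: good_flag (good_rinv g1 lcu' lcK) => x _ /=.
  exact: negbK.
move=> p'' Hp; apply: (stable (rinv p'')) => v vT /=.
apply: (@raut_inj p''); rewrite bwK Hp ?map_f //=.
by rewrite fwK.
Qed.

(** * Words in two automorphisms *)

(* A letter is a pair (generator, sign); the last letter of a word acts first. *)
Definition letter (P : bool -> raut) (l : bool * bool) : raut := dir l.2 (P l.1).

Definition evw (P : bool -> raut) (w : seq (bool * bool)) (x : M) : M :=
  foldr (fun l y => letter P l y) x w.

Lemma evw_cat P w1 w2 x : evw P (w1 ++ w2) x = evw P w1 (evw P w2 x).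
Proof. exact: foldr_cat. Qed.

Lemma evw_nseq P n l x : evw P (nseq n l) x = iter n (letter P l) x.
Proof. by elim: n => //= n ->. Qed.

Lemma evw_dist P w x y : d (evw P w x) (evw P w y) = d x y.
Proof. by elim: w => //= l w IH; rewrite raut_dist. Qed.

Lemma evw_lt P w x y : (evw P w x < evw P w y)%O = (x < y)%O.
Proof. by elim: w => //= l w IH; rewrite raut_lt. Qed.

Lemma evw_le P w x y : (evw P w x <= evw P w y)%O = (x <= y)%O.
Proof. by rewrite !leNgt evw_lt. Qed.

Lemma dir_fix sg (h : raut) c : h c = c -> dir sg h c = c.
Proof. by case: sg => //= hc; rewrite -{1}hc fwK. Qed.

Lemma evw_fix (P : bool -> raut) w c : (forall t, P t c = c) -> evw P w c = c.
Proof. by move=> Pc; elim: w => //= l w ->; rewrite dir_fix. Qed.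

(** * Alternating play of the two generators *)

Section Play.
Variables (A : seq M) (P0 : bool -> raut) (F : bool -> seq M).
Variables (up : bool -> pred M) (c0 : M).
Hypothesis c0F : forall t, c0 \in F t.
Hypothesis up_lc : forall t, loc_const (F t) (up t).

Definition common := [seq c <- F true | c \in F false].

Lemma commonP c : reflect (forall t, c \in F t) (c \in common).
Proof.
rewrite mem_filter; apply: (iffP andP) => [[cf ct] []//|H]; by split.
Qed.

Lemma both_letters t c : c \in F t -> c \in F (~~ t) -> forall t', c \in F t'.
Proof. by case: t => ? ? []. Qed.

Lemma F_any t : {subset F t <= F true ++ F false}.
Proof. by move=> c; rewrite mem_cat; case: t => ->; rewrite ?orbT. Qed.

Lemma btw_common t x y : btw common x y -> btw (F t) x y.
Proof.
by case/btwP=> c [/commonP cC xc cy]; apply/btwP; exists c; rewrite cC.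
Qed.

Lemma loc_const_common t f : loc_const common f -> loc_const (F t) f.
Proof. by move=> lc x y xy nb; apply: lc => //; apply: contraNN nb => /btw_common. Qed.

(** The position after the word [u]: [S t] is the part of [P t] already committed, and [B] collects
    the points in use. *)
Record state (K : pred M) (P : bool -> raut) (S : bool -> seq M) (B : seq M)
    (u : seq (bool * bool)) : Prop := State {
  st_good : forall t, good K (F t) (up t) (P t) (S t);
  st_sub : forall t, {subset A <= S t};
  st_agree : forall t, {in A, P t =1 P0 t};
  st_dom : forall t, {subset S t ++ map (P t) (S t) <= B};
  st_im : {in A, forall x, evw P u x \in B};
  st_stable : forall P' : bool -> raut, (forall t, {in S t, P' t =1 P t}) ->
    {in A, evw P' u =1 evw P u} }.

(** That is, [z] is strictly above all points of [W] in its own interval of [common]. *)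
Definition top_at (W : seq M) (z : M) :=
  {in W, forall b, (z <= b)%O -> btw common z b}.

Lemma state_fix K P S B u : state K P S B u -> forall t c, c \in F t -> P t c = c.
Proof. by move=> st t c cF; have [_ hF _ _] := st_good st t; apply: hF. Qed.

Lemma state_evw_common K P S B u c : state K P S B u -> c \in common ->
  evw P u c = c.
Proof. by move=> st /commonP cF; apply: evw_fix => t; apply: (state_fix st). Qed.

Lemma evw_lt_common K P S B u c x : state K P S B u -> c \in common ->
  (evw P u x < c)%O = (x < c)%O.
Proof. by move=> st cC; rewrite -{1}(state_evw_common st cC) evw_lt. Qed.

(** The conclusions concern the old [B], which contains the committed part of the other generator;
    that part is untouched by this move. A point at the top stays there: a point of [F t] above it
    lies in the domain, hence beyond a common fixed point. *)
Lemma step K P S B u t sg : loc_const common K -> state K P S B u ->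
  exists P' S' B' n, let u' := nseq n.+1 (t, sg) ++ u in
  [/\ state K P' S' B' u' /\ {subset S' (~~ t) ++ map (P' (~~ t)) (S' (~~ t)) <= B},
    {in A, forall x, evw P u x \in F t -> evw P' u' x = evw P u x} /\
    {in A & F t, forall x c, (evw P' u' x < c)%O = (evw P u x < c)%O},
    {in A & B, forall x b, exists2 c, c \in F t &
       d (evw P u x) c + d c b <= d (evw P' u' x) b},
    {in A, forall x, ~~ K (evw P u x) -> up t (evw P u x) = sg ->
       evw P u x \notin F t ->
       {in B, forall b, (evw P' u' x <= b)%O -> btw (F t) (evw P u x) b}} &
    {in A, forall x, K (evw P u x) ->
       top_at (S t ++ map (P t) (S t)) (evw P u x) -> top_at B (evw P' u' x)}].
Proof.
move=> lcK st; have lcK' := loc_const_common (t := t) lcK.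
have [p' [T [n [[p'S ST] gT stab HM HO]]]] :=
  signed_phase B sg (st_good st t) (c0F t) (@up_lc t) lcK'.
pose P' t' := if t' == t then p' else P t'.
pose S' t' := if t' == t then T else S t'.
have P't : P' t = p' by rewrite /P' eqxx.
have S't : S' t = T by rewrite /S' eqxx.
have nt : (~~ t == t) = false by case: t {p'S ST gT stab HM HO lcK' P' S' P't S't}.
have SS' t' : {subset S t' <= S' t'} by rewrite /S'; case: eqP => [->|_ x].
have PP' t' : {in S t', P' t' =1 P t'} by rewrite /P'; case: eqP => [->|_ x].
pose u' := nseq n.+1 (t, sg) ++ u.
have ev (Q : bool -> raut) x : x \in A -> (forall t', {in S t', Q t' =1 P t'}) ->
    evw Q u' x = iter n.+1 (dir sg (Q t)) (evw P u x).
  move=> xA QP; rewrite evw_cat evw_nseq /letter /=; congr (_ (iter _ _ _)).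
  exact: (st_stable st).
have ev' x : x \in A -> evw P' u' x = iter n.+1 (dir sg p') (evw P u x).
  by move=> xA; rewrite ev // P't.
pose B' := B ++ (T ++ map p' T) ++ map (evw P' u') A.
have p'F c : c \in F t -> dir sg p' c = c.
  by move=> cF; apply: dir_fix; case: gT => _ hF _ _; apply: hF.
exists P', S', B', n; split.
- split; last first.
    by move=> b; rewrite /P' /S' nt; apply: (st_dom st).
  split.
  + by move=> t'; rewrite /P' /S'; case: eqP => [->//|_]; apply: (st_good st).
  + by move=> t' x xA; apply: SS'; apply: (st_sub st).
  + by move=> t' x xA; rewrite PP' ?(st_agree st) // (st_sub st).
  + move=> t' b; rewrite /P' /S'; case: eqP => [_|_] bS; rewrite /B' 2!mem_cat.
      by rewrite bS orbT.
    by rewrite (st_dom st bS).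
  + by move=> x xA; rewrite /B' !mem_cat (map_f (evw P' u') xA) !orbT.
  + move=> Q HQ x xA.
    have HQ' t' : {in S t', Q t' =1 P t'}.
      by move=> s sS; rewrite HQ ?PP' //; apply: SS'.
    rewrite -/u' ev' // ev // stab //; first by move=> s sT; rewrite HQ ?P't ?S't.
    exact: (st_im st).
- split; first by move=> x xA xF; rewrite -/u' ev' // iter_fix // p'F.
  move=> x c xA cF; rewrite -/u' ev' //.
  by rewrite -[c in LHS](iter_fix n.+1 (p'F _ cF)) iter_raut_lt.
- by move=> x b xA bB; rewrite -/u' ev' //; apply: HM => //; apply: (st_im st).
- move=> x xA Kx ux xF b bB; rewrite -/u' ev' //.
  by apply: HO => //; [apply: (st_im st) | left].
- move=> x xA Kx tx b bB; rewrite -/u' ev' // => le1.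
  have /btwP[c [cF xc cb]] : btw (F t) (evw P u x) b.
    apply: HO le1 => //; first exact: (st_im st).
    by right; split=> // a aS /(tx _ aS) /btw_common.
  have cS : c \in S t ++ map (P t) (S t).
    by rewrite mem_cat; case: (st_good st t) => FS _ _ _; rewrite FS.
  have /btwP[e [eC xe ec]] := tx c cS (ltW xc).
  apply/btwP; exists e; split=> //; last exact: le_trans cb.
  have eF : dir sg p' e = e by apply: p'F; apply/commonP.
  by rewrite -(iter_fix n.+1 eF) iter_raut_lt.
Qed.

(** Here [t] is the generator whose turn it is; the points of [K] must be at the top relative to its
    committed part only. *)
Definition conf K P S B u t := state K P S B u /\
  {in A, forall x, x \notin common -> K x ->
    top_at (S t ++ map (P t) (S t)) (evw P u x)}.

Lemma loc_const_evw K P S B u f x : state K P S B u -> loc_const common f ->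
  f (evw P u x) = f x.
Proof.
move=> st lc; case: (leP x (evw P u x)) => [le1|/ltW le1].
  apply/esym/lc => //; apply/btwP => -[c [cC xc]].
  by rewrite -{1}(state_evw_common st cC) evw_le leNgt xc.
apply: lc => //; apply/btwP => -[c [cC]].
by rewrite (evw_lt_common _ st cC) ltNge => /negP.
Qed.

Lemma conf_step K P S B u t sg : loc_const common K -> conf K P S B u t ->
  exists P' S' B' n, let u' := nseq n.+1 (t, sg) ++ u in
  [/\ conf K P' S' B' u' (~~ t) /\ {subset S' (~~ t) ++ map (P' (~~ t)) (S' (~~ t)) <= B},
    {in A, forall x, evw P u x \in F t -> evw P' u' x = evw P u x} /\
    {in A & F t, forall x c, (evw P' u' x < c)%O = (evw P u x < c)%O},
    {in A & B, forall x b, exists2 c, c \in F t &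
       d (evw P u x) c + d c b <= d (evw P' u' x) b} &
    {in A, forall x, ~~ K x -> up t (evw P u x) = sg -> evw P u x \notin F t ->
       {in B, forall b, (evw P' u' x <= b)%O -> btw (F t) (evw P u x) b}}].
Proof.
move=> lcK [st tK]; have [P' [S' [B' [n [[st' sB] H1 H2 H3 H4]]]]] := step t sg lcK st.
exists P', S', B', n; split=> //.
  split=> //; split=> // x xA xC Kx b bS.
  apply: H4 (sB _ bS) => //; first by rewrite (loc_const_evw _ st lcK).
  exact: tK.
by move=> x xA Kx; apply: H3 => //; rewrite (loc_const_evw _ st lcK).
Qed.

Lemma common_sub t : {subset common <= F t}.
Proof. by move=> c /commonP. Qed.

Lemma F_dom K P S B u t : state K P S B u -> {subset F t <= S t ++ map (P t) (S t)}.
Proof.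
by move=> st c cF; rewrite mem_cat; case: (st_good st t) => FS _ _ _; rewrite FS.
Qed.

(** Relative to the committed part of [t], the point [z] is just below the next fixed point of the
    other generator. *)
Definition near (P : bool -> raut) (S : bool -> seq M) t (z : M) :=
  {in S t ++ map (P t) (S t), forall b, (z <= b)%O -> btw (F (~~ t)) z b}.

(** The sign is the recorded direction at the current image of [x], so that this image moves up. *)
Lemma near_step K P S B u t x : loc_const common K -> conf K P S B u t ->
  x \in A -> ~~ K x -> evw P u x \notin F t ->
  exists P' S' B' u', [/\ conf K P' S' B' u' (~~ t),
    near P' S' (~~ t) (evw P' u' x) &
    {in B, forall b, (evw P' u' x <= b)%O -> btw (F t) (evw P u x) b}].
Proof.
move=> lcK cf xA Kx zF.
have [P' [S' [B' [n [[cf' sB] [_ H1] _ H3]]]]] := conf_step (up t (evw P u x)) lcK cf.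
exists P', S', B', (nseq n.+1 (t, up t (evw P u x)) ++ u); split=> //; last exact: H3.
move=> b /sB bB /(H3 x xA Kx erefl zF _ bB) /btwP[c [cF zc cb]].
by apply/btwP; exists c; rewrite negbK H1.
Qed.

Lemma seq_min (s : seq M) x : x \in s -> exists2 m, m \in s & {in s, forall y, (m <= y)%O}.
Proof.
elim: s x => // a s IH x _; case: s IH => [_|b s IH].
  by exists a; rewrite ?inE // => y; rewrite inE => /eqP ->.
have [|m ms Hm] := IH b; first by rewrite inE eqxx.
case: (leP a m) => am; [exists a | exists m].
- by rewrite inE eqxx.
- by move=> y; rewrite inE => /orP[/eqP ->//|/Hm]; apply: le_trans.
- by rewrite inE ms orbT.
- by move=> y; rewrite inE => /orP[/eqP ->|/Hm //]; apply: ltW.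
Qed.

(* Alternating the two generators, the point climbs from the next fixed point of
   one to the next fixed point of the other, until the two coincide. *)
Lemma rise_near K x n P S B u t : loc_const common K -> x \in A -> ~~ K x ->
  conf K P S B u t -> near P S t (evw P u x) ->
  (count (fun g => evw P u x < g)%O (F true ++ F false) <= n)%N ->
  exists P' S' B' u' t', conf K P' S' B' u' t' /\
    top_at (S' t' ++ map (P' t') (S' t')) (evw P' u' x).
Proof.
move=> lcK xA Kx; elim: n P S B u t => [|n IH] P S B u t cf nr cnt.
  exists P, S, B, u, t; split=> // b bS /(nr _ bS) /btwP[c [cF zc _]].
  move: cnt; rewrite leqn0 => /eqP cnt0; move: zc.
  have : ~~ has (fun g => evw P u x < g)%O (F true ++ F false) by rewrite has_count cnt0.
  by move/hasPn => /(_ c (F_any cF)) /negP.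
set z := evw P u x in nr cnt *.
case: (boolP (all (fun b => (z <= b)%O ==> btw common z b) (S t ++ map (P t) (S t)))).
  move=> /allP tp; exists P, S, B, u, t; split=> // b bS zb.
  by have := tp b bS; rewrite zb.
case/allPn => b bS; rewrite negb_imply => /andP[zb nb].
have [st _] := cf.
have zF : z \notin F t.
  apply/negP => zF; have /btwP[c [_ zc cz]] := nr z (F_dom st zF) (lexx _).
  by move: zc; rewrite ltNge cz.
have /btwP[c [cF zc cb]] := nr b bS zb.
have [|c1] := @seq_min [seq c <- F (~~ t) | (z < c)%O] c.
  by rewrite mem_filter zc.
rewrite mem_filter => /andP[zc1 c1F] c1min.
have [P' [S' [B' [u' [cf' nr' HO]]]]] := near_step lcK cf xA Kx zF.
apply: IH cf' nr' _; rewrite -ltnS; apply: leq_trans cnt.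
(* Otherwise a point [e] of [F t] lies between [z] and [c1]. By [near] a fixed point of the other
   generator lies in between, so minimality of [c1] gives [e = c1], a common fixed point below
   [b]. *)
have c1z' : (c1 < evw P' u' x)%O.
  rewrite ltNge; apply/negP => /HO.
  have c1B : c1 \in B by apply: (st_dom st); apply: F_dom st _ c1F.
  move=> /(_ c1B) /btwP[e [eF ze ec1]].
  have /btwP[c2 [c2F zc2 c2e]] := nr e (F_dom st eF) (ltW ze).
  have c12 : (c1 <= c2)%O by apply: c1min; rewrite mem_filter zc2.
  have ee : e = c1 by apply/eqP; rewrite eq_le ec1 (le_trans c12 c2e).
  move/negP: nb; apply; apply/btwP; exists c1; split=> //.
    apply/commonP; apply: both_letters c1F; by rewrite -ee.
  by apply: le_trans cb; apply: c1min; rewrite mem_filter zc.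
apply: (count_lt (y := c1)) => //.
- exact: F_any c1F.
- by move=> g; apply: lt_trans; apply: lt_trans c1z'.
- by rewrite -leNgt ltW.
Qed.

(** If [t] fixes the current image of [x], a power of [t] is played only to pass the turn. Were that
    image fixed by both generators, it would equal [x], against [x \notin common]. *)
Lemma rise K x P S B u t : loc_const common K -> x \in A -> ~~ K x ->
  x \notin common -> conf K P S B u t ->
  exists P' S' B' u' t', conf K P' S' B' u' t' /\
    top_at (S' t' ++ map (P' t') (S' t')) (evw P' u' x).
Proof.
move=> lcK xA Kx xC.
have key Q S1 B1 v t1 : conf K Q S1 B1 v t1 -> evw Q v x \notin F t1 ->
    exists P' S' B' u' t', conf K P' S' B' u' t' /\
    top_at (S' t' ++ map (P' t') (S' t')) (evw P' u' x).
  move=> cf zF; have [P' [S' [B' [u' [cf' nr' _]]]]] := near_step lcK cf xA Kx zF.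
  exact: (rise_near lcK xA Kx cf' nr' (leqnn _)).
move=> cf; case: (boolP (evw P u x \in F t)) => zF; last exact: key cf zF.
have [P' [S' [B' [n [[cf' _] [H1 _] _ _]]]]] := conf_step true lcK cf.
apply: (key _ _ _ _ _ cf'); rewrite H1 //; apply/negP => zF'.
have zC : evw P u x \in common.
  by apply/commonP; apply: both_letters zF zF'.
have [st _] := cf.
have : evw P u (evw P u x) = evw P u x by apply: (state_evw_common st zC).
move=> e; suff ex : evw P u x = x by rewrite ex (negbTE xC) in zC.
apply/eqP; rewrite eq_le -[X in X && _](evw_le P u) -[X in _ && X](evw_le P u).
by rewrite e lexx.
Qed.

(* The components of the complement of [common] that meet [D]; it serves as [K]
   when the points of [D] have already been brought to the top. *)
Definition region (D : seq M) : pred M :=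
  fun v => has (fun y => all (fun c => (v < c)%O == (y < c)%O) common) D.

Lemma region_lc D : loc_const common (region D).
Proof.
move=> x y xy nb; apply: eq_has => z; apply: eq_in_all => c cC.
suff -> : (x < c)%O = (y < c)%O by [].
apply/idP/idP => [xc|]; last exact: le_lt_trans.
by rewrite ltNge; apply: contraNN nb => cy; apply/btwP; exists c.
Qed.

Lemma state_mono (K K' : pred M) P S B u : (forall x, K x -> K' x) ->
  state K P S B u -> state K' P S B u.
Proof.
move=> KK' [g H1 H2 H3 H4 H5]; split=> // t.
have [G1 G2 G3 G4] := g t; split=> // s sS Ks; apply: G4 => //.
by apply: contraNN Ks => /KK'.
Qed.

Lemma all_top n D P S B u t : conf (region D) P S B u t ->
  (count (fun x => (x \notin common) && ~~ region D x) A <= n)%N ->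
  exists D' P' S' B' u' t', conf (region D') P' S' B' u' t' /\
    {in A, forall x, x \notin common -> region D' x}.
Proof.
elim: n D P S B u t => [|n IH] D P S B u t cf cnt.
  exists D, P, S, B, u, t; split=> // x xA xC.
  have : ~~ has (fun x => (x \notin common) && ~~ region D x) A.
    by rewrite has_count -leqNgt.
  by move/hasPn => /(_ x xA); rewrite xC negbK.
case: (boolP (all (fun x => (x \notin common) ==> region D x) A)).
  move=> /allP al; exists D, P, S, B, u, t; split=> // x xA xC.
  by have := al x xA; rewrite xC.
case/allPn => y yA; rewrite negb_imply => yC.
(* The least remaining point is raised: the other points of its interval are above it, so they reach
   the top with it. *)
have [|x] := @seq_min [seq x <- A | (x \notin common) && ~~ region D x] y.
  by rewrite mem_filter yC.
rewrite mem_filter => /andP[/andP[xC Dx] xA] xmin.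
have [P' [S' [B' [u' [t' [[st' tK] tx]]]]]] := rise (@region_lc D) xA Dx xC cf.
have Dsub z : region D z -> region (x :: D) z by rewrite /region /= => ->; rewrite orbT.
apply: (IH (x :: D) P' S' B' u' t').
  split; first exact: state_mono st'.
  move=> z zA zC; case: (boolP (region D z)) => Dz; first by move=> _; apply: tK.
  rewrite /region /= -/(region D z) (negbTE Dz) orbF => /allP zx b bS zb.
  have xz : (x <= z)%O by apply: xmin; rewrite mem_filter zC Dz.
  have /btwP[c [cC xc cb]] : btw common (evw P' u' x) b.
    by apply: tx bS _; apply: le_trans zb; rewrite evw_le.
  apply/btwP; exists c; split=> //; move: xc.
  by rewrite !(evw_lt_common _ st' cC) (eqP (zx _ cC)).
rewrite -ltnS; apply: leq_trans cnt; apply: (count_lt (y := x)) => //.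
- by move=> z /andP[-> /=]; apply: contraNN => /Dsub.
- rewrite negb_and; apply/orP; right; rewrite negbK /region /=; apply/orP; left.
  by apply/allP => c _; rewrite eqxx.
- by rewrite xC Dx.
Qed.

(** * Distances through common fixed points *)

Lemma evw_dist_common K P S B u x c : state K P S B u -> c \in common ->
  d (evw P u x) c = d x c.
Proof. by move=> st cC; rewrite -{1}(state_evw_common st cC) evw_dist. Qed.

(** Each round routes the distance through a fixed point of the generator just played. Either this
    equals the target, which is then common, or passing from one to the other costs at least [e]. *)
Lemma metric_rounds K P S B u t e i : loc_const common K -> conf K P S B u t ->
  {in F true ++ F false &, forall c c', 0 < d c c' -> e <= d c c'} ->
  exists P' S' B' u' t', conf K P' S' B' u' t' /\
    {in A & F t', forall x c,
      (exists2 g, g \in common & d x g + d g c <= d (evw P' u' x) c) \/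
      i%:R * e <= d (evw P' u' x) c}.
Proof.
move=> lcK cf He; elim: i => [|i [P1 [S1 [B1 [u1 [t1 [cf1 IH]]]]]]].
  exists P, S, B, u, t; split=> // x c _ _; right; by rewrite mul0r.
have [P2 [S2 [B2 [n [[cf2 sB] _ HM _]]]]] := conf_step true lcK cf1.
exists P2, S2, B2, (nseq n.+1 (t1, true) ++ u1), (~~ t1); split=> // x c' xA c'F.
have c'B : c' \in B1 by have [st2 _] := cf2; apply: sB; apply: (F_dom st2 c'F).
have [c cF le1] := HM x c' xA c'B.
case: (eqVneq c c') => [ecc|ncc].
  rewrite -ecc in c'F le1 *; have cC : c \in common.
    by apply/commonP; apply: both_letters cF c'F.
  left; exists c => //; case: cf1 => st1 _.
  by rewrite -(evw_dist_common x st1 cC).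
have le2 := He c c' (F_any cF) (F_any c'F) (d_gt0 ncc).
have [[g gC le3]|le3] := IH x c xA cF.
  by left; exists g => //; have := d_tri g c c'; lra.
right; rewrite -[i.+1]addn1 natrD mulrDl mul1r; lra.
Qed.

Definition ready P S (u : seq (bool * bool)) t :=
  {in A & S t ++ map (P t : raut) (S t), forall x b,
    exists2 g, g \in common & d x g + d g b <= d (evw P u x) b}.

Lemma ready_step K P S B u t sg : loc_const common K -> conf K P S B u t ->
  {in A & F t, forall x c, exists2 g, g \in common & d x g + d g c <= d (evw P u x) c} ->
  exists P' S' B' n, let u' := nseq n.+1 (t, sg) ++ u in
    conf K P' S' B' u' (~~ t) /\ ready P' S' u' (~~ t).
Proof.
move=> lcK cf HF; have [P' [S' [B' [n [[cf' sB] _ HM _]]]]] := conf_step sg lcK cf.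
exists P', S', B', n; split=> // x b xA /sB bB.
have [c cF le1] := HM x b xA bB; have [g gC le2] := HF x c xA cF.
by exists g => //; have := d_tri g c b; lra.
Qed.

(** After enough rounds the second alternative of [metric_rounds] exceeds every path through [c0],
    which is itself a common fixed point. *)
Lemma get_ready K P S B u t : loc_const common K -> conf K P S B u t ->
  exists P' S' B' u' t', conf K P' S' B' u' t' /\ ready P' S' u' t'.
Proof.
move=> lcK cf.
have [e e0 He] := seq_pos_lbound (F true ++ F false) d.
have [R R0 HR] := seq_ubound (A ++ (F true ++ F false)) (fun x b => d x c0 + d c0 b).
pose i := Num.bound (R / e).
have ibig : R <= i%:R * e.
  by rewrite -ler_pdivrMr // ltW // archi_boundP // divr_ge0 // ltW.
have [P1 [S1 [B1 [u1 [t1 [cf1 H1]]]]]] := metric_rounds i lcK cf He.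
have [|P' [S' [B' [n [cf' rd]]]]] := @ready_step K P1 S1 B1 u1 t1 true lcK cf1.
  move=> x c xA cF; have [//|le1] := H1 x c xA cF.
  exists c0; first exact/commonP.
  apply: le_trans le1; apply: le_trans ibig; apply: HR; first by rewrite mem_cat xA.
  by rewrite mem_cat (F_any cF) orbT.
by exists P', S', B', (nseq n.+1 (t1, true) ++ u1), (~~ t1).
Qed.

(** Over the committed part, a point of [u A] outside [common] is determined by its distances to
    [common] and its interval. Since [P t] fixes [common], such a point is related alike to [s] and
    to [P t s], so it may be declared fixed. *)
Lemma ready_fix K P S B u t : conf K P S B u t -> ready P S u t ->
  {in A, forall x, x \notin common -> K x} ->
  exists P' : bool -> raut, [/\ forall t', {in A, P' t' =1 P0 t'},
    {in A, evw P' u =1 evw P u} & {in A, forall x, P' t (evw P u x) = evw P u x}].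
Proof.
move=> [st tK] rd allK; set h := P t.
have hC c : c \in common -> h c = c.
  by move=> cC; apply: (state_fix st); apply: common_sub.
have zle x s : x \in A -> x \notin common -> s \in S t ->
    [/\ d (evw P u x) s = d (evw P u x) (h s),
        (evw P u x < s)%O = (evw P u x < h s)%O &
        (s < evw P u x)%O = (h s < evw P u x)%O].
  move=> xA xC sS; have tx := tK x xA xC (allK x xA xC).
  set z := evw P u x in tx *.
  have sD : s \in S t ++ map h (S t) by rewrite mem_cat sS.
  have hsD : h s \in S t ++ map h (S t) by rewrite mem_cat map_f ?orbT.
  have ne b : b \in S t ++ map h (S t) -> z != b.
    move=> bD; apply/eqP => e; have := tx b bD; rewrite -e => /(_ (lexx _)).
    by case/btwP=> c [_ zc cz]; move: zc; rewrite ltNge cz.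
  have dgh g : g \in common -> d g (h s) = d g s.
    by move=> gC; rewrite -{1}(hC _ gC) raut_dist.
  have ele : (z <= s)%O = (z <= h s)%O.
    apply/idP/idP => [/(tx _ sD)|/(tx _ hsD)] /btwP[c [cC zc cs]];
      apply: le_trans (ltW zc) _.
      by rewrite -[c]hC // raut_le.
    by rewrite -(raut_le h) hC.
  split.
  - apply/eqP; rewrite eq_le; apply/andP; split.
      have [g gC le1] := rd x (h s) xA hsD.
      have := d_tri z g s; rewrite /z (evw_dist_common x st gC) -/z.
      by move: le1; rewrite (dgh g gC) -/z; lra.
    have [g gC le1] := rd x s xA sD.
    have := d_tri z g (h s); rewrite /z (evw_dist_common x st gC) (dgh g gC) -/z.
    by move: le1; rewrite -/z; lra.
  - by rewrite !lt_neqAle (ne _ sD) (ne _ hsD) ele.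
  - by rewrite !ltNge ele.
have [||p' [p'S p'z]] := @homog_ext h (S t) [seq (evw P u x, evw P u x) | x <- A].
- by move=> _ _ /mapP[x xA ->] /mapP[y yA ->].
- move=> _ s /mapP[x xA ->] sS /=; case: (boolP (x \in common)) => xC; last exact: zle.
  rewrite (state_evw_common st xC) -{2 4 6}(hC _ xC) raut_dist !raut_lt.
  by [].
pose P' t' := if t' == t then p' else P t'.
have P'S t' : {in S t', P' t' =1 P t'} by rewrite /P'; case: eqP => [->|_ x].
exists P'; split.
- by move=> t' x xA; rewrite P'S ?(st_agree st) // (st_sub st).
- exact: (st_stable st).
- move=> x xA; rewrite /P' eqxx.
  by apply: (p'z (evw P u x, evw P u x)); apply: (map_f (fun x => (evw P u x, evw P u x))).
Qed.

End Play.

Definition winv (w : seq (bool * bool)) := rev [seq (l.1, ~~ l.2) | l <- w].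

Lemma evw_winv P w x : evw P (winv w) (evw P w x) = x.
Proof.
elim: w => //= l w IH; rewrite /winv /= rev_cons -cats1 evw_cat -/(winv w).
have -> : evw P [:: (l.1, ~~ l.2)] (letter P l (evw P w x)) = evw P w x.
  by case: l => t []; rewrite /= /letter /= ?fwK ?bwK.
exact: IH.
Qed.

Lemma evw_winvr P w x : evw P w (evw P (winv w) x) = x.
Proof.
suff ww : winv (winv w) = w by rewrite -{1}ww; apply: evw_winv.
rewrite /winv map_rev revK -map_comp -[RHS]map_id.
by apply: eq_map => -[t sg] /=; rewrite negbK.
Qed.

(** * Trapping a finite set *)

Lemma far_point (B : seq M) (L : pred M) :
  {in B &, forall b b', (b < b')%O -> L b' -> L b} ->
  exists e R, 0 < R /\ {in B, forall b, d e b = R /\ (b < e)%O = L b}.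
Proof.
move=> HL; have [R R0 HR] := seq_ubound B d.
have [||||e He] := realize (B := B) (r := fun=> R + 1) (L := L) => //.
- by move=> b _; lra.
- by move=> b b' _ _; have := d_ge0 b' b; lra.
- by move=> b b' bB b'B; have := HR _ _ bB b'B; lra.
by exists e, (R + 1); split=> //; lra.
Qed.

(** A point equidistant from [S] and [h S], in a cut invariant under [h], can be declared fixed. *)
Lemma fix_far (h : raut) (S : seq M) (L : pred M) e R :
  0 < R -> {in S ++ map h S, forall b, d e b = R /\ (b < e)%O = L b} ->
  {in S, forall s, L (h s) = L s} ->
  exists h' : raut, {in S, h' =1 h} /\ h' e = e.
Proof.
move=> R0 He HL.
have ne b : b \in S ++ map h S -> e != b.
  by move=> /He[ed _]; apply/eqP => eb; move: ed R0; rewrite eb d_xx => ->; rewrite ltxx.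
have [||h' [h'S h'e]] := @homog_ext h S [:: (e, e)].
- by move=> p q; rewrite !inE => /eqP -> /eqP ->.
- move=> p s; rewrite inE => /eqP -> sS /=.
  have sD : s \in S ++ map h S by rewrite mem_cat sS.
  have hD : h s \in S ++ map h S by rewrite mem_cat (map_f h sS) orbT.
  have [-> E1] := He _ sD; have [-> E2] := He _ hD.
  rewrite E1 E2 HL //; split=> //.
  by rewrite !lt_neqAle (ne _ sD) (ne _ hD) !leNgt E1 E2 HL.
by exists h'; split=> //; apply: (h'e (e, e)); rewrite inE.
Qed.

(** The cut is the set of points below some iterate of [a]. No iterate of [a] passes [b], because
    the iterates of [b] descend. *)
Lemma invariant_cut (g : raut) a b : (a < b)%O -> (a < g a)%O -> (g b < b)%O ->
  exists L : pred M, [/\ forall v w, (v < w)%O -> L w -> L v, forall v, L (g v) = L v,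
    L a & ~~ L b].
Proof.
move=> ab aga gbb; exists (fun v => `[< exists k, (v < iter k g a)%O >]); split.
- move=> v w vw /asboolP[k wk]; apply/asboolP; exists k; exact: lt_trans wk.
- move=> v; apply/asbool_equiv_eq; split=> -[k vk].
    exists k; rewrite -(raut_lt g); apply: lt_trans vk _.
    by rewrite -iterS iterSr iter_raut_lt.
  by exists k.+1; rewrite /= raut_lt.
- by apply/asboolP; exists 1%N.
apply/asboolP => -[k]; apply/negP; rewrite -leNgt.
apply: ltW; apply: (@lt_le_trans _ _ (iter k g b)); first by rewrite iter_raut_lt.
elim: k => //= k IH; apply: le_trans (ltW gbb).
by rewrite raut_le.
Qed.

Lemma separate (h : raut) (S : seq M) a b : a \in S -> b \in S -> (a < b)%O ->
  h a != a -> h b != b -> (a < h a)%O != (b < h b)%O ->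
  exists (h' : raut) e, [/\ {in S, h' =1 h}, h' e = e, (a < e)%O & (e <= b)%O].
Proof.
move=> aS bS ab ha hb sg.
have [L [Ldown Linv La Lb]] : exists L : pred M,
    [/\ forall v w, (v < w)%O -> L w -> L v, forall v, L (h v) = L v, L a & ~~ L b].
  case: (ltgtP a (h a)) ha sg => [aha _|haa _|//];
    case: (ltgtP b (h b)) hb => [bhb|hbb|//] _ // _.
    exact: invariant_cut.
  have [||L [L1 L2 L3 L4]] := @invariant_cut (rinv h) a b ab.
  (* Points that move apart under [h] approach each other under its inverse. *)
  - by rewrite -(raut_lt h) /= bwK.
  - by rewrite -(raut_lt h) /= bwK.
  by exists L; split=> // v; rewrite -[LHS]L2 /= fwK.
have [|e [R [R0 He]]] := @far_point (S ++ map h S) L.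
  by move=> v w _ _; apply: Ldown.
have [h' [h'S h'e]] := fix_far R0 He (fun s _ => Linv s).
have [_ Ea] : d e a = R /\ (a < e)%O = L a by apply: He; rewrite mem_cat aS.
have [_ Eb] : d e b = R /\ (b < e)%O = L b by apply: He; rewrite mem_cat bS.
by exists h', e; rewrite Ea leNgt Eb.
Qed.

Lemma separate_all (h : raut) (S : seq M) (l : seq (M * M)) :
  {in l, forall p, p.1 \in S /\ p.2 \in S} ->
  exists (h' : raut) E, [/\ {in S, h' =1 h}, {in E, forall e, h' e = e} &
    {in l, forall p, (p.1 < p.2)%O -> h p.1 != p.1 -> h p.2 != p.2 ->
       (p.1 < h p.1)%O != (p.2 < h p.2)%O -> btw E p.1 p.2}].
Proof.
elim: l => [|p l IH] lS; first by exists h, [::].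
have [|h1 [E [h1S h1E HE]]] := IH; first by move=> q ql; apply: lS; rewrite inE ql orbT.
have [p1S p2S] : p.1 \in S /\ p.2 \in S by apply: lS; rewrite inE eqxx.
case: (boolP [&& (p.1 < p.2)%O, h p.1 != p.1, h p.2 != p.2 &
              (p.1 < h p.1)%O != (p.2 < h p.2)%O]); last first.
  move=> np; exists h1, E; split=> // q; rewrite inE => /orP[/eqP -> A1 A2 A3 A4|/HE //].
  by rewrite A1 A2 A3 A4 in np.
case/and4P=> A1 A2 A3 A4.
have SE x : x \in S -> x \in S ++ E by move=> xS; rewrite mem_cat xS.
have [|||h2 [e [h2S h2e pe ep]]] := @separate h1 (S ++ E) p.1 p.2 (SE _ p1S) (SE _ p2S) A1.
- by rewrite h1S.
- by rewrite h1S.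
- by rewrite !h1S.
exists h2, (e :: E); split.
- by move=> s sS; rewrite h2S ?SE // h1S.
- move=> f; rewrite inE => /orP[/eqP -> //|fE].
  by rewrite h2S ?mem_cat ?fE ?orbT // h1E.
- move=> q; rewrite inE => /orP[/eqP -> _ _ _ _|ql B1 B2 B3 B4].
    by apply/btwP; exists e; rewrite inE eqxx.
  by rewrite /btw /= -/(btw E q.1 q.2) (HE q ql) ?orbT.
Qed.

(** Once new fixed points separate all pairs of [S] that move in opposite directions, each interval
    has a single direction, so coherence holds for every [K]. *)
Lemma make_good (h : raut) (S : seq M) c0 : c0 \in S -> h c0 = c0 ->
  exists (h' : raut) (S' F : seq M) (up : pred M),
    [/\ {in S, h' =1 h}, {subset S <= S'}, forall K, good K F up h' S',
        c0 \in F & loc_const F up].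
Proof.
move=> c0S hc0.
have [|h' [E [h'S h'E HE]]] := @separate_all h S [seq (x, y) | x <- S, y <- S].
  by move=> _ /allpairsP[[x y] [xS yS ->]].
pose S' := S ++ E; pose F := [seq s <- S' | h' s == s].
pose up x := has (fun a => (a < h' a)%O && all (fun c => (x < c)%O == (a < c)%O) F) S.
have EF e : e \in E -> e \in F.
  by move=> eE; rewrite mem_filter h'E // eqxx mem_cat eE orbT.
have sep x y : x \in S -> y \in S -> (x < y)%O -> h' x != x -> h' y != y ->
    (x < h' x)%O != (y < h' y)%O -> btw F x y.
  move=> xS yS xy; rewrite !h'S // => hx hy sg.
  have /btwP[e [eE xe ey]] : btw E x y.
    by apply: (HE (x, y)) => //; apply/allpairsP; exists (x, y).
  by apply/btwP; exists e; rewrite EF.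
exists h', S', F, up; split=> //.
- by move=> s sS; rewrite mem_cat sS.
- move=> K; split.
  + by move=> c; rewrite mem_filter => /andP[].
  + by move=> c; rewrite mem_filter => /andP[/eqP].
  + by move=> s sS' hs; rewrite mem_filter hs eqxx.
  move=> s sS' _ sF; have hs : h' s != s by move: sF; rewrite mem_filter sS' andbT.
  have sS : s \in S.
    by move: sS'; rewrite mem_cat => /orP[//|/EF sF']; rewrite sF' in sF.
  apply/idP/idP => [shs|/hasP[a aS /andP[aha /allP same]]].
    by apply/hasP; exists s => //; rewrite shs; apply/allP.
  have ha : h' a != a by rewrite gt_eqF.
  apply: contraT => nshs.
  have sg : (a < h' a)%O != (s < h' s)%O by rewrite aha (negbTE nshs).
  case: (ltgtP a s) => [as_|sa|ea]; last by rewrite -ea aha in nshs.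
    have /btwP[e [eF ae es]] := sep _ _ aS sS as_ ha hs sg.
    by move: (same _ eF); rewrite ae ltNge es.
  rewrite eq_sym in sg; have /btwP[e [eF ae es]] := sep _ _ sS aS sa hs ha sg.
  by move: (same _ eF); rewrite ae ltNge es.
- by rewrite mem_filter mem_cat c0S h'S // hc0 eqxx.
move=> x y xy nb; apply: eq_has => a; congr (_ && _); apply: eq_in_all => c cF.
suff -> : (x < c)%O = (y < c)%O by [].
apply/idP/idP => [xc|]; last exact: le_lt_trans.
by rewrite ltNge; apply: contraNN nb => cy; apply/btwP; exists c.
Qed.

(** A free image of a point outside the domain is new. The auxiliary point [a] keeps that domain
    nonempty. *)
Lemma move_some (h : raut) (S : seq M) :
  exists (h' : raut) e, {in S, h' =1 h} /\ h' e != e.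
Proof.
have [//|a _] := @far_point [::] predT.
have [//|e [R [R0 He]]] := @far_point (a :: S) predT.
have eS : e \notin a :: S.
  by apply/negP => /He[]; rewrite d_xx => R00; rewrite -R00 ltxx in R0.
have [|h' [h'S E1 _ _]] := @ext1 h (a :: S) [:: e] a e true _ eS; first by rewrite inE eqxx.
exists h', e; split=> [s sS|]; first by apply: h'S; rewrite inE sS orbT.
apply/eqP => he; have [|b bS] := E1 e; first by rewrite inE eqxx.
have [-> _] := He b bS; rewrite he d_xx.
by have := d_ge0 (h b) e; lra.
Qed.

Lemma trap_word (G : bool -> raut) (x0 : M) (P : bool -> raut) (A : seq M) :
  (exists t, G t x0 != x0) ->
  exists (P' : bool -> raut) w, [/\ forall t, {in A, P' t =1 P t},
    evw G w x0 != x0 & {in A, forall x, evw P' w x = x}].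
Proof.
move=> Gx0.
(* A far point above everything in play can be fixed by both generators; it guarantees a common
   fixed point. *)
have [//|c0 [R [R0 Hc0]]] :=
  @far_point (A ++ map (P true) A ++ map (P false) A) predT.
have c0t t : exists h : raut, {in A, h =1 P t} /\ h c0 = c0.
  apply: (@fix_far (P t) A predT c0 R) => // b bA; apply: Hc0.
  by move: bA; rewrite !mem_cat => /orP[->//|]; case: t => ->; rewrite ?orbT.
have good_t t : exists (h' : raut) (S' F : seq M) (up : pred M),
    [/\ {in A, h' =1 P t}, {subset A <= S'}, forall K, good K F up h' S',
        c0 \in F & loc_const F up].
  have [h [hA hc0]] := c0t t.
  have [|h' [S' [F [up [H1 H2 H3 H4 H5]]]]] := @make_good h (c0 :: A) c0 _ hc0.
    by rewrite inE eqxx.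
  exists h', S', F, up; split=> //.
    by move=> x xA; rewrite H1 ?inE ?xA ?orbT // hA.
  by move=> x xA; apply: H2; rewrite inE xA orbT.
have [h1 [S1 [F1 [up1 [a1 b1 g1 m1 l1]]]]] := good_t true.
have [h2 [S2 [F2 [up2 [a2 b2 g2 m2 l2]]]]] := good_t false.
pose Q (t : bool) := if t then h1 else h2.
pose S (t : bool) := if t then S1 else S2.
pose F (t : bool) := if t then F1 else F2.
pose up (t : bool) := if t then up1 else up2.
have c0F t : c0 \in F t by case: t.
have up_lc t : loc_const (F t) (up t) by case: t.
pose B := (S1 ++ map h1 S1) ++ (S2 ++ map h2 S2).
(* The play starts with the empty word and an empty region, so no point need be at the top yet. *)
have cf0 : conf A P F up (region F [::]) Q S B [::] true.
  split=> //; split.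
  - by case.
  - by case.
  - by case.
  - by case=> b bS; rewrite mem_cat bS ?orbT.
  - by move=> x xA; rewrite /= !mem_cat b1.
  - by [].
have [D [P1 [S1' [B1 [u1 [t1 [cf1 allK]]]]]]] := all_top c0F up_lc cf0 (leqnn _).
have lcK := @region_lc F D.
have [P3 [S3 [B3 [u [t [cf rd]]]]]] := get_ready c0F up_lc lcK cf1.
have Gfix y w : evw G w x0 = y -> (forall t, G t y = y) -> False.
  move=> ey fixy; have [t' /negP] := Gx0; apply.
  suff -> : x0 = y by rewrite fixy.
  by rewrite -[LHS](evw_winv G w) ey evw_fix.
have finish P4 S4 B4 v s : conf A P F up (region F D) P4 S4 B4 v s ->
    ready A F P4 S4 v s -> G s (evw G v x0) != evw G v x0 ->
    exists (P' : bool -> raut) w, [/\ forall t, {in A, P' t =1 P t},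
      evw G w x0 != x0 & {in A, forall x, evw P' w x = x}].
  move=> cf4 rd4 nG; have [P' [H1 H2 H3]] := ready_fix cf4 rd4 allK.
  exists P', (winv v ++ (s, true) :: v); split=> //.
    apply: contra nG => /eqP; rewrite evw_cat /= /letter /= => e.
    by rewrite -{2}e evw_winvr.
  move=> x xA; rewrite evw_cat /= /letter /= H2 // H3 // -H2 //.
  exact: evw_winv.
case: (boolP (G t (evw G u x0) == evw G u x0)) => [/eqP Gt|]; last exact: finish cf rd.
have [|P4 [S4 [B4 [n [cf4 rd4]]]]] := @ready_step A P F up c0 c0F up_lc _ P3 S3 B3 u t true lcK cf.
  by move=> x c xA cF; apply: rd => //; case: cf => st _; apply: (F_dom st).
apply: (finish _ _ _ _ _ cf4 rd4).
have eG : evw G (nseq n.+1 (t, true) ++ u) x0 = evw G u x0.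
  by rewrite evw_cat evw_nseq iter_fix.
rewrite eG; apply/eqP => Gt'; apply: (Gfix _ _ eG) => t'.
by case: t t' Gt Gt' {cf rd cf4 rd4 eG} => [] [].
Qed.

(** For an inverse letter, the support must contain the resulting point, since the generator takes
    it back. *)
Lemma evw_support (P : bool -> raut) w (X : seq M) :
  exists V : seq M, forall Q : bool -> raut, (forall t, {in V, Q t =1 P t}) ->
    {in X, evw Q w =1 evw P w}.
Proof.
elim: w => [|l w [V IH]]; first by exists [::].
exists (V ++ map (evw P w) X ++ map (evw P (l :: w)) X) => Q HQ x xX.
have e : evw Q w x = evw P w x.
  by apply: IH xX => t y yV; apply: HQ; rewrite mem_cat yV.
rewrite /= e; case: l HQ {IH} => t [] HQ; rewrite /letter /=.
  by apply: HQ; rewrite !mem_cat (map_f (evw P w) xX) orbT.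
apply: (@raut_inj (Q t)); rewrite bwK HQ ?bwK //.
by rewrite !mem_cat (map_f (evw P ((t, false) :: w)) xX) !orbT.
Qed.

End OrderedMetric.

(** * Meagerness *)

Section Urysohn.
Variables (disp : Order.disp_t) (M : orderType disp) (d : M -> M -> rat).
Let lt (x y : M) : Prop := (x < y)%O.
Hypothesis qu : is_QUprec d lt.

Lemma In_mem (T : eqType) (x : T) s : List.In x s <-> x \in s.
Proof.
elim: s => //= a s IH; rewrite inE; split.
  by case=> [->|/IH ->]; rewrite ?eqxx ?orbT.
by case/orP=> [/eqP ->|/IH]; [left|right].
Qed.

Lemma qu_metric : [/\ forall x y, 0 <= d x y, forall x y, d x y = 0 <-> x = y,
  forall x y, d x y = d y x & forall x y z, d x z <= d x y + d y z].
Proof. by case: qu => -[]. Qed.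

Lemma raut_of_aut h : is_aut d lt h -> exists R : raut d, fw R = h.
Proof.
case=> -[g hK gK] hd hlt.
have hltb x y : (h x < h y)%O = (x < y)%O by apply/idP/idP => /hlt.
by exists (Raut hK gK hd hltb).
Qed.

Lemma aut_of_raut (R : raut d) : is_aut d lt R.
Proof.
split; first by exists (bw R); [apply: fwK | apply: bwK].
  exact: raut_dist.
by move=> x y; rewrite /lt raut_lt.
Qed.

Lemma qu_point : exists x : M, True.
Proof.
case: qu => _ _ univ _.
have [|e _] := univ 1%N (fun _ _ => 0) (fun _ _ => False).
  split=> //; first by move=> x y; rewrite (ord1 x) (ord1 y).
  by split=> [x []|x y z []|x y]; rewrite (ord1 x) (ord1 y) => -[].
by exists (e ord0).
Qed.

Lemma qu_homog (l : seq (M * M)) :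
  {in l &, forall p q, d p.1 q.1 = d p.2 q.2 /\ (p.1 < q.1)%O = (p.2 < q.2)%O} ->
  exists h : raut d, {in l, forall p, h p.1 = p.2}.
Proof.
move=> Hl; have [x _] := qu_point; case: qu => _ _ _ hom.
pose pt (i : 'I_(size l)) := nth (x, x) l i.
have ptl i : pt i \in l by apply: mem_nth.
have [||h [hb hd hlt hp]] := hom (size l) (fun i => (pt i).1) (fun i => (pt i).2).
- by move=> i j; have [] := Hl _ _ (ptl i) (ptl j).
- by move=> i j; rewrite /lt; have [_ ->] := Hl _ _ (ptl i) (ptl j).
have [//|R Rh] := @raut_of_aut h.
exists R => p pl; rewrite Rh.
have ip : (index p l < size l)%N by rewrite index_mem.
by have := hp (Ordinal ip); rewrite /pt /= nth_index.
Qed.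

(** Universality embeds the abstract space consisting of [B] and one more point; homogeneity carries
    the copy of [B] back to [B]. *)
Lemma qu_realize (B : seq M) (r : M -> rat) (L : pred M) :
  {in B, forall b, 0 < r b} ->
  {in B &, forall b b', r b <= r b' + d b' b} ->
  {in B &, forall b b', d b b' <= r b + r b'} ->
  {in B &, forall b b', (b < b')%O -> L b' -> L b} ->
  exists e, {in B, forall b, d e b = r b /\ (b < e)%O = L b}.
Proof.
move=> r0 r1 r2 Ld; have [x _] := qu_point; case: qu => _ _ univ _.
have [d0 dE dS dT] := qu_metric.
pose dO (o o' : option M) : rat := match o, o' with
  | Some a, Some b => d a b | Some a, None | None, Some a => r a | None, None => 0 end.
pose ltO (o o' : option M) : bool := match o, o' with
  | Some a, Some b => (a < b)%O | Some a, None => L a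
  | None, Some a => ~~ L a | None, None => false end.
(* Repetitions are removed because distinct indices must be at positive distance; the last index [n]
   is the new point [None]. *)
pose s := undup B; pose n := size s.
pose pt (i : 'I_n.+1) := if (i < n)%N then Some (nth x s i) else None.
have sB b : (b \in s) = (b \in B) by rewrite mem_undup.
have ptB i b : pt i = Some b -> b \in B.
  by rewrite /pt; case: ifP => // lti [<-]; rewrite -sB mem_nth.
have pt_inj : injective pt.
  move=> i j; rewrite /pt; case: ifP => li; case: ifP => lj //.
    case=> /eqP; rewrite nth_uniq ?undup_uniq // => /eqP e.
    exact: val_inj.
  move=> _; apply: val_inj; have := ltn_ord i; have := ltn_ord j.
  by move: li lj => /=; lia.
have [|e He] := univ n.+1 (fun i j => dO (pt i) (pt j)) (fun i j => ltO (pt i) (pt j)).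
  split.
  - move=> i j; case Ei: (pt i) => [a|]; case Ej: (pt j) => [b|] //=.
      by apply: ltW; apply: r0; apply: ptB Ei.
    by apply: ltW; apply: r0; apply: ptB Ej.
  - move=> i j; split=> [|->]; last first.
      by case: (pt j) => [b|] //=; apply/dE.
    move=> eij; apply: pt_inj; move: eij.
    case Ei: (pt i) => [a|]; case Ej: (pt j) => [b|] //=.
    + by move/dE => ->.
    + by move=> ra; have := r0 _ (ptB _ _ Ei); rewrite ra ltxx.
    + by move=> ra; have := r0 _ (ptB _ _ Ej); rewrite ra ltxx.
  - by move=> i j; case: (pt i) => [a|]; case: (pt j) => [b|] /=.
  - move=> i j k; case Ei: (pt i) => [a|]; case Ej: (pt j) => [b|];
      case Ek: (pt k) => [c|] //=; rewrite ?addr0 ?add0r //.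
    + by rewrite addrC dS; apply: r1; [apply: ptB Ei | apply: ptB Ej].
    + by apply: r2; [apply: ptB Ei | apply: ptB Ek].
    + by apply: r1; [apply: ptB Ek | apply: ptB Ej].
    + by rewrite addr_ge0 // ltW // r0 // (ptB _ _ Ej).
  - split.
    + by move=> i; case: (pt i) => [a|] //=; rewrite ltxx.
    + move=> i j k; case Ei: (pt i) => [a|]; case Ej: (pt j) => [b|];
        case Ek: (pt k) => [c|] //=.
      * exact: lt_trans.
      * by move=> ab; apply: Ld ab; [apply: ptB Ei | apply: ptB Ej].
      * move=> La nLc; rewrite ltNge; apply/negP => ca; move/negP: nLc; apply.
        move: ca; rewrite le_eqVlt => /orP[/eqP ->//|ca].
        by apply: Ld ca La; [apply: ptB Ek | apply: ptB Ei].
      * move=> nLb bc; apply: contraNN nLb => Lc.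
        by apply: Ld bc Lc; [apply: ptB Ej | apply: ptB Ek].
      * by move=> /negP.
    + move=> i j nij; have : pt i <> pt j by move/pt_inj.
      case Ei: (pt i) => [a|]; case Ej: (pt j) => [b|] //=.
      * move=> ab; case: (ltgtP a b) => [||e]; [by left|by right|].
        by rewrite e in ab.
      * by move=> _; case: (boolP (L a)); [left|right].
      * by move=> _; case: (boolP (L b)); [right|left].
pose w (i : 'I_n) : 'I_n.+1 := widen_ord (leqnSn n) i.
have ptw i : pt (w i) = Some (nth x s i) by rewrite /pt /= ltn_ord.
have ptm : pt ord_max = None by rewrite /pt /= ltnn.
have [|h Hh] := @qu_homog [seq (e (w i), nth x s i) | i : 'I_n].
  move=> _ _ /mapP[i _ ->] /mapP[j _ ->] /=.
  have [E1 E2] := He (w i) (w j); rewrite E1 !ptw /=; split=> //.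
  by move: E2; rewrite !ptw /lt /= => E2; apply/idP/idP => /E2.
exists (h (e ord_max)) => b; rewrite -sB => bs.
have ib : (index b s < n)%N by rewrite index_mem.
have hb : h (e (w (Ordinal ib))) = b.
  rewrite (Hh (e (w (Ordinal ib)), nth x s (Ordinal ib))) /= ?nth_index //.
  by apply/mapP; exists (Ordinal ib); rewrite ?mem_enum //= nth_index.
rewrite -{1 3}hb raut_dist raut_lt.
have [E1 _] := He ord_max (w (Ordinal ib)); have [_ E2] := He (w (Ordinal ib)) ord_max.
rewrite E1; rewrite ptw ptm /= nth_index // in E2 *; split=> //.
by apply/idP/idP => /E2.
Qed.

Lemma nowhere_dense2_open (X : (M -> M) * (M -> M) -> Prop) :
  (forall p (V : seq M), aut2 d lt p -> exists q (W : seq M),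
     [/\ aut2 d lt q, agree q.1 p.1 V, agree q.2 p.2 V &
       forall r, aut2 d lt r -> agree r.1 q.1 W -> agree r.2 q.2 W -> ~ X r]) ->
  nowhere_dense2 d lt X.
Proof.
move=> H p [O [[Oaut Oopen] OX Op]].
have [V HV] := Oopen p Op.
have [q [W [aq q1 q2 HW]]] := H p V (Oaut p Op).
have [_ []] := OX q (HV q aq q1 q2).
exists (fun r => [/\ aut2 d lt r, agree r.1 q.1 W & agree r.2 q.2 W]); split.
- split=> [r []//|r [ar r1 r2]]; exists W => r' ar' r'1 r'2; split=> // x xW.
    by rewrite r'1 ?r1.
  by rewrite r'2 ?r2.
- by move=> r [ar r1 r2]; split=> //; apply: HW.
- by [].
Qed.

Lemma rauts_of_aut2 p : aut2 d lt p ->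
  exists P : bool -> raut d, fw (P true) = p.1 /\ fw (P false) = p.2.
Proof.
case=> /raut_of_aut[R1 E1] /raut_of_aut[R2 E2].
by exists (fun t => if t then R1 else R2).
Qed.

Lemma aut2_of_rauts (P : bool -> raut d) : aut2 d lt (fw (P true), fw (P false)).
Proof. by split; apply: aut_of_raut. Qed.

Lemma gen_inj (f1 f2 x : M -> M) : injective f1 -> injective f2 ->
  gen f1 f2 x -> injective x.
Proof.
move=> i1 i2; elim=> {x} //.
- by move=> x y _ ix _ iy; apply: inj_comp.
- by move=> x y _ _ _ yK; apply: can_inj yK.
Qed.

Lemma gen_evw (P : bool -> raut d) w : gen (P true) (P false) (evw P w).
Proof.
elim: w => [|[t sg] w IH]; first exact: gen_id.
apply: (gen_comp (x := letter P (t, sg))) IH.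
have gt : gen (P true) (P false) (P t) by case: t; [apply: gen_l | apply: gen_r].
case: sg => //; apply: (gen_inv gt); [apply: fwK | apply: bwK].
Qed.

(** * The action of a similarity on words *)

Section Similar.
Variables (G P : bool -> raut d) (phi : (M -> M) -> (M -> M)).
Let H := gen (G true) (G false).
Let K := gen (P true) (P false).
Hypothesis phi_in : forall x, H x -> K (phi x).
Hypothesis phiM : forall x y, H x -> H y -> phi (x \o y) = phi x \o phi y.
Hypothesis phi_gen : forall t, phi (G t) = P t.

(** The map [phi id] is idempotent and injective. *)
Lemma phi_id : phi id = id.
Proof.
have Hid : H id by apply: gen_id.
have e := phiM Hid Hid.
have inj : injective (phi id).
  by apply: gen_inj (phi_in Hid); apply: raut_inj.
apply: funext => x; apply: inj.
exact: esym (congr1 (fun f => f x) e).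
Qed.

Lemma phi_letter l : phi (letter G l) = letter P l.
Proof.
case: l => t []; first exact: phi_gen.
have Ht : H (G t) by rewrite /H; case: (t); [apply: gen_l | apply: gen_r].
have Hi : H (bw (G t)).
  by apply: (gen_inv Ht); [apply: fwK | apply: bwK].
have e : phi (G t) \o phi (bw (G t)) = id.
  rewrite -phiM // -[RHS]phi_id; congr (phi _).
  by apply: funext => x /=; rewrite bwK.
apply: funext => x; rewrite /letter /=.
by rewrite -[in RHS](congr1 (fun f => f x) e) /= phi_gen fwK.
Qed.

Lemma phi_evw w : phi (evw G w) = evw P w.
Proof.
elim: w => [|l w IH]; first exact: phi_id.
have -> : evw G (l :: w) = letter G l \o evw G w by [].
rewrite phiM ?IH ?phi_letter //; last exact: gen_evw.
exact: (gen_evw G [:: l]).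
Qed.

End Similar.

Theorem meager_sim_class g1 g2 : is_aut d lt g1 -> is_aut d lt g2 ->
  meager2 d lt (sim_class d lt g1 g2).
Proof.
move=> a1 a2; have [G [E1 E2]] := @rauts_of_aut2 (g1, g2) (conj a1 a2).
rewrite /= in E1 E2; subst g1 g2.
have [d0 dE dS dT] := qu_metric.
have similar p : sim_class d lt (G true) (G false) p ->
    exists P : bool -> raut d, exists phi psi, [/\ fw (P true) = p.1, fw (P false) = p.2,
      (forall w, phi (evw G w) = evw P w), (forall w, psi (evw P w) = evw G w) &
      cont_on d lt (gen p.1 p.2) psi].
  case=> ap [phi [psi [[h1 h2] k1 k2 m [e1 e2 _ cpsi]]]].
  have [P [F1 F2]] := rauts_of_aut2 ap.
  exists P, phi, psi; split=> //; rewrite -F1 -F2 in h1 h2 e1 e2.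
    by apply: phi_evw => // -[].
  move=> w; rewrite -(@phi_evw G P phi) //; last by case.
  by apply: k1; apply: gen_evw.
have [nofix|allfix] := pselect (exists x0 t, G t x0 != x0); last first.
  (* Here both generators are the identity, hence so is the first entry of every similar pair. *)
  exists (fun _ p => aut2 d lt p /\ p.1 = id); split; last first.
    move=> p sp; exists 0%N; split; first by case: sp.
    have [P [phi [psi [F1 _ Hphi _ _]]]] := similar p sp.
    rewrite -F1; have := Hphi [:: (true, true)].
    have -> : evw G [:: (true, true)] = evw G [::].
      apply: funext => x; apply/eqP; apply: contra_notT allfix => n.
      by exists x, true.
    by rewrite Hphi => e; apply: (esym e).
  move=> _; apply: nowhere_dense2_open => p V ap.
  have [P [F1 F2]] := rauts_of_aut2 ap.
  have [h [e [hV he]]] := move_some d0 dE dS dT qu_realize qu_homog (P true) V.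
  exists (fw h, p.2), [:: e]; split=> //.
  - by split; [apply: aut_of_raut | case: ap].
  - by move=> x /In_mem xV; rewrite /= hV // F1.
  - move=> r ar r1 _ [_ rid]; move/eqP: he; apply.
    by rewrite -[LHS]r1 /=; [rewrite rid | left].
have [x0 Gx0] := nofix.
case: (qu) => _ [code codeI] _ _.
pose D (F : seq M) p := forall P : bool -> raut d, fw (P true) = p.1 -> fw (P false) = p.2 ->
  forall w, evw G w x0 != x0 -> ~ {in F, forall x, evw P w x = x}.
(* Bounding the codes of the points of [F] by [n] turns the union over all finite [F] into a
   sequence. *)
exists (fun n p => aut2 d lt p /\ exists2 F, {in F, forall x, (code x < n)%N} & D F p).
split; last first.
  move=> p sp; have [P [phi [psi [F1 F2 Hphi Hpsi cpsi]]]] := similar p sp.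
  (* The stabilizer of [x0] is open; continuity of [psi] gives a finite [F] such that a word fixing
     [F] under [p] fixes [x0] under [G]. *)
  pose O h := is_aut d lt h /\ h x0 = x0.
  have [|O' [[_ O'open] HO]] := cpsi O.
    split=> [h []//|h [ah hx0]]; exists [:: x0] => k ak kh; split=> //.
    by rewrite kh //; left.
  have gid : gen p.1 p.2 id by apply: gen_id.
  have psi_id : psi id = id by apply: (Hpsi [::]).
  have /O'open[F HF] : O' id.
    apply/(HO id gid); rewrite psi_id; split=> //.
    by apply: (@aut_of_raut (Raut (@erefl M) (@erefl M) (fun _ _ => erefl) (fun _ _ => erefl))).
  exists (\max_(x <- F) (code x)).+1; split; first by case: sp.
  exists F; first by move=> x xF; rewrite ltnS; apply: leq_bigmax_seq.
  move=> Q Q1 Q2 w Gw fixF; move/eqP: Gw; apply.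
  have QP : evw Q w = evw P w.
    apply: funext => x; have [V HV] := evw_support P w [:: x].
    apply: HV; last by rewrite inE.
    by case=> y _; rewrite ?Q1 ?Q2 ?F1 ?F2.
  have gw : gen p.1 p.2 (evw P w) by rewrite -F1 -F2; apply: gen_evw.
  have aw : is_aut d lt (evw P w).
    split; first by exists (evw P (winv w)); [apply: evw_winv | apply: evw_winvr].
      by move=> x y; apply: evw_dist.
    by move=> x y; rewrite /lt evw_lt.
  have : O' (evw P w) by apply: HF => // x /In_mem xF; rewrite -QP fixF.
  by move/(HO _ gw); rewrite Hpsi => -[].
move=> n.
(* As [code] is injective, one finite set contains every admissible [F]; trapping it defeats all of
   them at once. *)
have [Fn HFn] : exists Fn : seq M, forall x, (code x < n)%N -> x \in Fn.
  elim: n => [|n [Fn HFn]]; first by exists [::].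
  have [[y cy]|ny] := pselect (exists y, code y = n).
    exists (y :: Fn) => x; rewrite ltnS leq_eqVlt inE => /orP[/eqP cx|/HFn ->]; last by rewrite orbT.
    by rewrite (codeI x y) ?eqxx // cx cy.
  exists Fn => x; rewrite ltnS leq_eqVlt => /orP[/eqP cx|/HFn //].
  by case: ny; exists x.
apply: nowhere_dense2_open => p V ap.
have [P [F1 F2]] := rauts_of_aut2 ap.
have [P' [w [PP' Gw fixA]]] :=
  trap_word d0 dE dS dT qu_realize qu_homog P (V ++ Fn) Gx0.
have [W HW] := evw_support P' w Fn.
exists (fw (P' true), fw (P' false)), W; split.
- exact: aut2_of_rauts.
- by move=> x /In_mem xV; rewrite /= PP' ?mem_cat ?xV // F1.
- by move=> x /In_mem xV; rewrite /= PP' ?mem_cat ?xV // F2.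
move=> r ar r1 r2 [_ [F Fcode DF]].
have [R [R1 R2]] := rauts_of_aut2 ar.
apply: (DF R R1 R2 w Gw) => x xF; have xFn := HFn x (Fcode x xF).
rewrite HW ?fixA ?mem_cat ?xFn ?orbT //.
by case=> y yW; [rewrite R1 r1 | rewrite R2 r2] => //; apply/In_mem.
Qed.

End Urysohn.

Theorem theorem5p6 (M : Type) (d : M -> M -> rat) (lt : M -> M -> Prop) :
  is_QUprec d lt ->
  forall g1 g2 : M -> M, is_aut d lt g1 -> is_aut d lt g2 ->
    meager2 d lt (sim_class d lt g1 g2).
Proof.
move=> qu; have [_ _ _ _ [irr trans tot]] : is_ometric d lt by case: qu.
(* Classical logic equips [M] with decidable equality and turns [lt] into a boolean total order. *)
pose T : choiceType := HB.pack M (gen_eqMixin M) (gen_choiceMixin M).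
pose ltb (x y : T) := `[< lt x y >].
have le_def (x y : T) : ((x == y) || ltb x y) = (x == y) || ltb x y by [].
have ltb_irr : irreflexive ltb by move=> x; apply/asboolP/irr.
have ltb_trans : transitive ltb.
  by move=> y x z /asboolP xy /asboolP yz; apply/asboolP; apply: trans yz.
have ltb_total (x y : T) : x != y -> ltb x y || ltb y x.
  by move=> /eqP/tot[xy|yx]; apply/orP; [left|right]; apply/asboolP.
pose T' : orderType (Order.Disp tt tt) := HB.pack T
  (@Order.LtOrder.Build (Order.Disp tt tt) T _ ltb _ _ le_def
     (fun x y => erefl) (fun x y => erefl) ltb_irr ltb_trans ltb_total).
have elt : lt = fun x y : T' => (x < y)%O.
  by apply: funext => x; apply: funext => y; apply: propext; split=> /asboolP.
rewrite elt in qu *; exact: (@meager_sim_class _ T' d qu).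
Qed.
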